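(* Let $a>0$ and let $\mathcal F_p$ be the space of $C^\infty$ functions $f:\mathbb R\to\mathbb R$ with $f(x)=f(x+a)$ for all $x\in\mathbb R$. Let $V\in\mathcal F_p$ be real-analytic and satisfy $V(x)=V(-x)$ for all $x\in\mathbb R$. Consider the operator $\mathcal L(f)=-\frac{d^2}{dx^2}f-V\cdot f$ on $\mathcal F_p$, and let $\lambda_1<\lambda_2\le\lambda_3\le\dots\uparrow+\infty$ be its spectrum, with eigenvalues repeated according to multiplicity, with a corresponding basis $f_1,f_2,f_3,\dots\in\mathcal F_p$ of eigenfunctions. Then every eigenspace $\{f\in\mathcal F_p : \mathcal L(f)=\lambda_j f\}$ is at most $2$-dimensional, and: (i) When the eigenspace for $\lambda_j$ is $1$-dimensional, it is spanned by an eigenfunction $f_j\in\mathcal F_p$ for which one of the following holds: $f_j(0)=1$ and $(\frac{d}{dx}f_j)(0)=0$; or $f_j(0)=0$ and $(\frac{d}{dx}f_j)(0)=1$. (ii) When the eigenspace for $\lambda_j$ is $2$-dimensional, and $\lambda_j=\lambda_{j+1}$, it has a basis $f_j,f_{j+1}\in\mathcal F_p$ with $f_j(0)=1$, $(\frac{d}{dx}f_j)(0)=0$ and $f_{j+1}(0)=0$, $(\frac{d}{dx}f_{j+1})(0)=1$. Furthermore, for each $j\ge 1$, any eigenfunction in $\mathcal F_p$ associated to $\lambda_j$ has exactly $j$ nodes if $j$ is even, and exactly $j-1$ nodes if $j$ is odd.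
   Context: An eigenfunction of $\mathcal L$ in $\mathcal F_p$ for the eigenvalue $\lambda\in\mathbb R$ is a function $f\in\mathcal F_p$, not identically zero, with $\mathcal L(f)=\lambda f$. The eigenvalues of $\mathcal L$ on $\mathcal F_p$ are real and form a discrete sequence $\lambda_1<\lambda_2\le\lambda_3\le\dots\uparrow+\infty$, listed with multiplicity, with simple first eigenvalue; corresponding eigenfunctions can be chosen to form an orthonormal basis with respect to the $L^2$ norm over $[0,a]$. The nodes of an eigenfunction $f\in\mathcal F_p$ are the points of the circle $\Sigma_p=\mathbb R/(x\sim x+a)$ at which $f$ vanishes (equivalently, the zeros of $f$ in $[0,a)$). *)

(* Defs.v *)
From Stdlib Require Import Reals List.
From Coquelicot Require Import Coquelicot.
Import ListNotations.
Open Scope R_scope.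

Definition smooth (f : R -> R) : Prop :=
  forall (n : nat) (x : R), ex_derive_n f n x.

Definition Fp (a : R) (f : R -> R) : Prop :=
  smooth f /\ forall x : R, f x = f (x + a).

Definition real_analytic (f : R -> R) : Prop :=
  forall x0 : R, exists (r : R) (c : nat -> R),
    0 < r /\ forall x : R, Rabs (x - x0) < r -> is_pseries c (x - x0) (f x).

Definition Lop (V f : R -> R) (x : R) : R := - Derive_n f 2 x - V x * f x.

Definition eigenspace (a : R) (V : R -> R) (mu : R) (f : R -> R) : Prop :=
  Fp a f /\ forall x : R, Lop V f x = mu * f x.

Definition eigenfunction (a : R) (V : R -> R) (mu : R) (f : R -> R) : Prop :=
  eigenspace a V mu f /\ exists x : R, f x <> 0.

Definition lincomb (c : list R) (b : list (R -> R)) (x : R) : R :=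
  fold_right Rplus 0 (map (fun p => fst p * snd p x) (combine c b)).

Definition is_basis (E : (R -> R) -> Prop) (b : list (R -> R)) : Prop :=
  (forall f, In f b -> E f) /\
  (forall c, length c = length b -> (forall x, lincomb c b x = 0) ->
     forall t, In t c -> t = 0) /\
  (forall f, E f ->
     exists c, length c = length b /\ forall x, f x = lincomb c b x).

Definition has_dim (E : (R -> R) -> Prop) (n : nat) : Prop :=
  exists b, length b = n /\ is_basis E b.

(* Sequences are indexed from 1: the values at index 0 are irrelevant.
   The last clause ranges over all real mu, so that lam lists every eigenvalue
   as often as its multiplicity; for mu not an eigenvalue the list is empty and
   the eigenspace is zero. *)
Definition is_spectrum (a : R) (V : R -> R) (lam : nat -> R) : Prop :=
  lam 1%nat < lam 2%nat /\
  (forall j : nat, (1 <= j)%nat -> lam j <= lam (S j)) /\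
  is_lim_seq lam p_infty /\
  (forall mu : R, exists l : list nat,
     NoDup l /\
     (forall j : nat, In j l <-> (1 <= j)%nat /\ lam j = mu) /\
     has_dim (eigenspace a V mu) (length l)).

(* g = sum_(j >= 1) c j * f j, with convergence in the L^2 norm over [0, a] *)
Definition L2_expansion (a : R) (f : nat -> R -> R) (c : nat -> R)
    (g : R -> R) : Prop :=
  is_lim_seq
    (fun n => RInt (fun x => (g x - sum_n_m (fun j => c j * f j x) 1 n) ^ 2) 0 a)
    0.

(* The f j are not required to be normalised or orthogonal: orthonormal bases,
   and their rescalings, are particular cases. *)
Definition eigenbasis (a : R) (V : R -> R) (lam : nat -> R)
    (f : nat -> R -> R) : Prop :=
  (forall j : nat, (1 <= j)%nat -> eigenfunction a V (lam j) (f j)) /\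
  (forall g : R -> R, Fp a g -> exists c : nat -> R,
     L2_expansion a f c g /\
     forall c' : nat -> R, L2_expansion a f c' g ->
       forall j : nat, (1 <= j)%nat -> c' j = c j).

(* The circle R / (x ~ x + a) is represented by the fundamental domain [0, a). *)
Definition has_nodes (a : R) (f : R -> R) (n : nat) : Prop :=
  exists l : list R,
    NoDup l /\ length l = n /\
    forall x : R, In x l <-> (0 <= x < a /\ f x = 0).

(* Main.v *)
Require Import Defs.
From Stdlib Require Import Reals List ZArith Lra Lia.
From Coquelicot Require Import Coquelicot.
Import ListNotations.
Open Scope R_scope.

(** With q = V + lam the eigenvalue equation is y'' = - q y, and V is symmetric
about 0 and, by periodicity, about a/2. Let c and s be the solutions with
(c, c')(0) = (1, 0) and (s, s')(0) = (0, 1). The reflection in 0 splits an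
eigenfunction f = f(0) c + f'(0) s into its even part f(0) c and its odd part
f'(0) s, each of which is periodic ([cosine_in_eigenspace],
[sine_in_eigenspace]); so an eigenspace is spanned by those of c and s that are
periodic, which gives the dimension bound and the bases. The reflection in a/2
shows that c is periodic iff c'(a/2) = 0 and s is periodic iff s(a/2) = 0: the
periodic problem on [0, a] is the union of the Neumann and of the Dirichlet
problem on [0, a/2].

Both are read off Pruefer angles. Writing y = r sin th, y' = r cos th turns the
equation into th' = cos^2 th + q sin^2 th, a scalar equation with a bounded
Lipschitz right-hand side. Let thN and thD be its solutions with
thN(0) = pi/2 and thD(0) = 0. Then lam is a Neumann eigenvalue iff
thN(a/2) = pi/2 + k pi for some k >= 0, and a Dirichlet eigenvalue iff
thD(a/2) = k pi for some k >= 1; call this k the level of lam.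

_Nodes._ As th' = 1 whenever th is a multiple of pi, such multiples are crossed
once and upwards, so the zeros of a periodic solution are counted by the number
of half-turns of its angle over a period. All angles which make a whole number
of half-turns make the same number, as angles stay ordered, and by reflection
thN or thD makes 2k of them: at level k every eigenfunction has 2k nodes
([level_nodes]).

_Levels._ The angles at a/2 depend continuously and strictly increasingly on
lam, and thD < thN < thD + pi. Hence the level is nondecreasing in lam, each
level is reached by at most one Neumann and at most one Dirichlet eigenvalue,
level 0 is reached, and below a level that is reached the intermediate value
theorem gives all the lower ones, each positive one for both problems. As the
sequence lists every eigenvalue with its multiplicity, level 0 occurs once and
every later level twice, in increasing order: lam_j has level floor(j/2)
([spectrum_levels]). *)

(** * Differential inequalities *)

Lemma is_derive_cast (f : R -> R) (x l l' : R) :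
  is_derive f x l -> l = l' -> is_derive f x l'.
Proof. now intros H <-. Qed.

Lemma is_derive_continuous (f : R -> R) (x l : R) :
  is_derive f x l -> continuous f x.
Proof. intros H. apply (ex_derive_continuous f x). now exists l. Qed.

Lemma exp_le_compat (x y : R) : x <= y -> exp x <= exp y.
Proof. intros [H | ->]; [left; now apply exp_increasing | apply Rle_refl]. Qed.

Lemma derive_nonneg_le (g dg : R -> R) (x y : R) :
  (forall t, x <= t <= y -> is_derive g t (dg t)) ->
  (forall t, x <= t <= y -> 0 <= dg t) -> x <= y -> g x <= g y.
Proof.
intros Hd Hp Hxy.
destruct (MVT_gen g x y dg) as [c [Hc E]].
- rewrite Rmin_left, Rmax_right by lra. intros t Ht. apply Hd. lra.
- rewrite Rmin_left, Rmax_right by lra. intros t Ht.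
  apply continuity_pt_filterlim. apply (is_derive_continuous g t (dg t)), Hd, Ht.
- rewrite Rmin_left, Rmax_right in Hc by lra.
  assert (H := Hp c Hc). nra.
Qed.

(** The square of the negative part is a differentiable measure of how far a
function has dropped below 0. *)
Lemma is_derive_sq_neg_part (z : R) :
  is_derive (fun z => Rmin z 0 ^ 2) z (2 * Rmin z 0).
Proof.
destruct (Rtotal_order z 0) as [Hz | [Hz | Hz]].
- apply is_derive_ext_loc with (fun z => z ^ 2).
  + exists (mkposreal (- z) ltac:(lra)). intros y Hy.
    apply Rabs_lt_between in Hy. simpl in Hy. unfold minus, plus, opp in Hy. simpl in Hy.
    rewrite Rmin_left by lra. reflexivity.
  + rewrite Rmin_left by lra. auto_derive; [easy | ring].
- subst z. rewrite Rmin_left by lra. rewrite Rmult_0_r.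
  apply is_derive_Reals. intros eps Heps.
  exists (mkposreal eps Heps). intros h Hh0 Hh. simpl in Hh.
  rewrite Rplus_0_l, (Rmin_left 0 0) by lra.
  unfold Rmin. destruct (Rle_dec h 0).
  + replace ((h ^ 2 - 0 ^ 2) / h - 0) with h by (field; lra). exact Hh.
  + replace ((0 ^ 2 - 0 ^ 2) / h - 0) with 0 by (field; lra). now rewrite Rabs_R0.
- apply is_derive_ext_loc with (fun _ => 0).
  + exists (mkposreal z Hz). intros y Hy.
    apply Rabs_lt_between in Hy. simpl in Hy. unfold minus, plus, opp in Hy. simpl in Hy.
    rewrite Rmin_right by lra. simpl. now rewrite Rmult_0_l.
  + rewrite Rmin_right by lra. rewrite Rmult_0_r. apply @is_derive_const.
Qed.

Lemma is_derive_mult_exp (u : R -> R) (c t l : R) :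
  is_derive u t l ->
  is_derive (fun t => u t * exp (c * t)) t ((l + c * u t) * exp (c * t)).
Proof.
intros H. auto_derive; [now exists l |].
rewrite (is_derive_unique (fun t : R => u t) _ _ H). ring.
Qed.

(** Where [d] is negative the hypothesis reads d' >= K d, so the square of the
negative part grows at most at the rate 2K; starting from 0, it stays 0. *)
Lemma barrier_nonneg (K x0 : R) (d dd : R -> R) :
  (forall t, is_derive d t (dd t)) -> (forall t, - (K * Rabs (d t)) <= dd t) ->
  0 <= d x0 -> forall x, x0 <= x -> 0 <= d x.
Proof.
intros Hd Hb H0 x Hx.
pose (w := fun t => - (Rmin (d t) 0 ^ 2) * exp (- (2 * K) * t)).
assert (Hw : w x0 <= w x).
{ apply derive_nonneg_le with
    (dg := fun t => 2 * (- (Rmin (d t) 0 * dd t) + K * Rmin (d t) 0 ^ 2)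
                    * exp (- (2 * K) * t)); [| | lra].
  - intros t _. unfold w.
    eapply is_derive_cast.
    + apply (is_derive_mult_exp (fun t => - Rmin (d t) 0 ^ 2)).
      apply @is_derive_opp, (is_derive_comp (fun z => Rmin z 0 ^ 2) d).
      * apply is_derive_sq_neg_part.
      * apply Hd.
    + unfold opp, scal; simpl; unfold mult; simpl. ring.
  - intros t _. apply Rmult_le_pos; [| left; apply exp_pos].
    assert (H := Hb t). unfold Rmin. destruct (Rle_dec (d t) 0).
    + rewrite Rabs_left1 in H by lra. nra.
    + lra. }
unfold w in Hw. rewrite (Rmin_right (d x0)) in Hw by lra.
assert (He := exp_pos (- (2 * K) * x)).
destruct (Rle_or_lt 0 (d x)) as [|Hn]; [easy | exfalso].
rewrite (Rmin_left (d x)) in Hw by lra.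
assert (Hs : 0 < d x ^ 2) by nra. nra.
Qed.

(** Once [d] is known to be nonnegative, d' + K d >= 0. *)
Lemma barrier (K x0 : R) (d dd : R -> R) :
  (forall t, is_derive d t (dd t)) -> (forall t, - (K * Rabs (d t)) <= dd t) ->
  0 <= d x0 ->
  forall x y, x0 <= x -> x <= y -> d x * exp (K * x) <= d y * exp (K * y).
Proof.
intros Hd Hb H0 x y Hx Hy.
apply derive_nonneg_le with (g := fun t => d t * exp (K * t))
  (dg := fun t => (dd t + K * d t) * exp (K * t)); [| | lra].
- intros t _. now apply is_derive_mult_exp.
- intros t Ht. apply Rmult_le_pos; [| left; apply exp_pos].
  assert (H := Hb t). rewrite Rabs_right in H; [lra |].
  apply Rle_ge, (barrier_nonneg K x0 d dd); auto. lra.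
Qed.

Lemma barrier_pos (K x0 : R) (d dd : R -> R) :
  (forall t, is_derive d t (dd t)) -> (forall t, - (K * Rabs (d t)) <= dd t) ->
  0 < d x0 -> forall x, x0 <= x -> 0 < d x.
Proof.
intros Hd Hb H0 x Hx.
assert (H := barrier K x0 d dd Hd Hb (Rlt_le _ _ H0) x0 x (Rle_refl _) Hx).
assert (H1 := exp_pos (K * x0)). assert (H2 := exp_pos (K * x)). nra.
Qed.

(** By [barrier], a nonnegative [d] cannot come back to 0: the weighted function
is nondecreasing, so it vanishes up to any of its zeros. *)
Lemma barrier_stuck (K x0 x1 : R) (d dd : R -> R) :
  (forall t, is_derive d t (dd t)) -> (forall t, - (K * Rabs (d t)) <= dd t) ->
  0 <= d x0 -> d x1 <= 0 -> forall x, x0 <= x <= x1 -> d x = 0.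
Proof.
intros Hd Hb H0 H1 x Hx.
assert (A := barrier_nonneg K x0 d dd Hd Hb H0 x (proj1 Hx)).
assert (B := barrier K x0 d dd Hd Hb H0 x x1 (proj1 Hx) (proj2 Hx)).
assert (E1 := exp_pos (K * x)). assert (E2 := exp_pos (K * x1)). nra.
Qed.

Lemma derive_zero_on (d : R -> R) (x0 x1 x l c : R) :
  is_derive d x l -> x0 < x < x1 -> (forall t, x0 <= t <= x1 -> d t = c) -> l = 0.
Proof.
intros Hd Hx Hc.
rewrite <- (is_derive_unique _ _ _ Hd).
rewrite (Derive_ext_loc d (fun _ => c)). apply Derive_const.
assert (He : 0 < Rmin (x - x0) (x1 - x)) by (apply Rmin_pos; lra).
exists (mkposreal _ He). intros y Hy.
apply Rabs_lt_between in Hy. simpl in Hy. unfold minus, plus, opp in Hy. simpl in Hy.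
assert (A := Rmin_l (x - x0) (x1 - x)). assert (B := Rmin_r (x - x0) (x1 - x)).
apply Hc. lra.
Qed.

(** Integrating a bound on the derivative, on both sides of 0 at once. *)
Lemma abs_le_of_derive (u du g dg : R -> R) :
  (forall t, is_derive u t (du t)) -> (forall t, is_derive g t (dg t)) ->
  (forall t, Rabs (du t) <= dg (Rabs t)) -> u 0 = 0 ->
  forall x, Rabs (u x) <= g (Rabs x) - g 0.
Proof.
assert (P : forall u du : R -> R, (forall t, is_derive u t (du t)) ->
  (forall t, is_derive g t (dg t)) -> (forall t, Rabs (du t) <= dg (Rabs t)) ->
  u 0 = 0 -> forall x, 0 <= x -> Rabs (u x) <= g x - g 0).
{ clear. intros u du Hu Hg Hb H0 x Hx.
  apply Rabs_le. split.
  - assert (H : g 0 + u 0 <= g x + u x); [| lra].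
    apply derive_nonneg_le with (g := fun t => g t + u t)
      (dg := fun t => dg t + du t); [| | lra].
    + intros t _. apply @is_derive_plus; auto.
    + intros t Ht. assert (H := Hb t). rewrite (Rabs_right t) in H by lra.
      apply Rabs_le_between in H. lra.
  - assert (H : g 0 - u 0 <= g x - u x); [| lra].
    apply derive_nonneg_le with (g := fun t => g t - u t)
      (dg := fun t => dg t - du t); [| | lra].
    + intros t _. apply @is_derive_minus; auto.
    + intros t Ht. assert (H := Hb t). rewrite (Rabs_right t) in H by lra.
      apply Rabs_le_between in H. lra. }
intros Hu Hg Hb H0 x.
destruct (Rle_or_lt 0 x) as [Hx | Hx].
- rewrite (Rabs_right x) by lra. now apply (P u du).
- rewrite (Rabs_left x) by lra.
  replace (u x) with ((fun t => u (- t)) (- x)) by (simpl; f_equal; ring).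
  apply (P (fun t => u (- t)) (fun t => - du (- t))).
  + intros t. auto_derive; [now exists (du (- t)) |].
    rewrite (is_derive_unique (fun t : R => u t) _ _ (Hu (- t))). ring.
  + exact Hg.
  + intros t. rewrite Rabs_Ropp, <- (Rabs_Ropp t). apply Hb.
  + rewrite Ropp_0. exact H0.
  + lra.
Qed.

(** * Global solutions of scalar differential equations *)

Fixpoint picard (F : R -> R -> R) (w : R) (n : nat) (x : R) : R :=
  match n with
  | O => w
  | S n => w + RInt (fun t => F t (picard F w n t)) 0 x
  end.

Definition ode_solution (F : R -> R -> R) (w x : R) : R :=
  real (Lim_seq (fun n => picard F w n x)).

Lemma is_derive_integral (g : R -> R) (w x : R) :
  (forall t, continuous g t) -> is_derive (fun x => w + RInt g 0 x) x (g x).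
Proof.
intros Hg. eapply is_derive_cast.
- apply @is_derive_plus.
  + apply @is_derive_const.
  + apply (is_derive_RInt g (fun x => RInt g 0 x) 0).
    * apply filter_forall. intros y. apply (RInt_correct g).
      apply (ex_RInt_continuous g). intros; apply Hg.
    * apply Hg.
- apply Rplus_0_l.
Qed.

Lemma lim_seq_abs_le (u : nat -> R) (l C : R) :
  (forall n, Rabs (u n) <= C) -> is_lim_seq u l -> Rabs l <= C.
Proof.
intros Hu Hl. apply (is_lim_seq_le _ _ (Rabs l) C Hu).
- apply (is_lim_seq_abs _ (Finite l) Hl).
- apply is_lim_seq_const.
Qed.

Lemma scaled_geometric_lim (C : R) : is_lim_seq (fun n => C * (1 / 2) ^ n) 0.
Proof.
replace (Finite 0) with (Rbar_mult C 0) by (simpl; f_equal; ring).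
apply is_lim_seq_scal_l, is_lim_seq_geom. rewrite Rabs_right; lra.
Qed.

(** The right-hand side is bounded and globally Lipschitz, so that the Picard
iterates converge on the whole line. *)
Section Picard.
Variables (F : R -> R -> R) (M K w : R).
Hypothesis F_bounded : forall t u, Rabs (F t u) <= M.
Hypothesis F_lipschitz : forall t u v, Rabs (F t u - F t v) <= K * Rabs (u - v).
Hypothesis F_continuous : forall u : R -> R,
  (forall t, continuous u t) -> forall t, continuous (fun t => F t (u t)) t.
Hypothesis K_pos : 0 < K.

Lemma picard_continuous (n : nat) (x : R) : continuous (picard F w n) x.
Proof.
revert x. induction n as [|n IH]; intros x.
- apply @continuous_const.
- apply (is_derive_continuous _ _ (F x (picard F w n x))).
  apply (is_derive_integral (fun t => F t (picard F w n t))). now apply F_continuous.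
Qed.

Lemma picard_derive (n : nat) (x : R) :
  is_derive (picard F w (S n)) x (F x (picard F w n x)).
Proof.
apply (is_derive_integral (fun t => F t (picard F w n t))).
apply F_continuous, picard_continuous.
Qed.

Lemma picard_at_0 (n : nat) : picard F w n 0 = w.
Proof.
destruct n; [easy |]. simpl. rewrite RInt_point. unfold zero; simpl. ring.
Qed.

Lemma M_nonneg : 0 <= M.
Proof. apply Rle_trans with (2 := F_bounded 0 0), Rabs_pos. Qed.

(** The weight exp (2 K |x|) replaces the usual factorials: integrating K times
the weight gives back half of it, whence the geometric factor. *)
Lemma picard_step (n : nat) (x : R) :
  Rabs (picard F w (S n) x - picard F w n x)
    <= M / K * exp (2 * K * Rabs x) * (1 / 2) ^ n.
Proof.
assert (HM := M_nonneg).
assert (Hexp : forall c t, is_derive (fun t => c * exp (2 * K * t)) t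
                             (c * (2 * K) * exp (2 * K * t))).
{ intros c t. auto_derive; [easy | ring]. }
assert (HMK : 0 <= M / K) by (apply Rdiv_le_0_compat; lra).
revert x. induction n as [|n IH]; intros x.
- apply Rle_trans with (M / K * exp (2 * K * Rabs x) - M / K * exp (2 * K * 0)).
  + apply (abs_le_of_derive (fun x => picard F w 1 x - picard F w 0 x)
             (fun x => F x w) (fun t => M / K * exp (2 * K * t))
             (fun t => M / K * (2 * K) * exp (2 * K * t))).
    * intros t. eapply is_derive_cast.
      -- apply @is_derive_minus; [apply (picard_derive 0) | apply @is_derive_const].
      -- apply Rminus_0_r.
    * intros t. apply Hexp.
    * intros t. apply Rle_trans with (1 := F_bounded _ _).
      replace (M / K * (2 * K)) with (2 * M) by (field; lra).
      assert (1 <= exp (2 * K * Rabs t)); [| nra].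
      assert (H := Rabs_pos t). assert (H1 := exp_ineq1_le (2 * K * Rabs t)). nra.
    * rewrite !picard_at_0. ring.
  + rewrite Rmult_0_r, exp_0. simpl. lra.
- set (c := M / K * (1 / 2) ^ S n).
  assert (Hc : 0 <= c) by (apply Rmult_le_pos; [easy | apply pow_le; lra]).
  apply Rle_trans with (c * exp (2 * K * Rabs x) - c * exp (2 * K * 0)).
  + apply (abs_le_of_derive (fun x => picard F w (S (S n)) x - picard F w (S n) x)
             (fun x => F x (picard F w (S n) x) - F x (picard F w n x))
             (fun t => c * exp (2 * K * t)) (fun t => c * (2 * K) * exp (2 * K * t))).
    * intros t. apply @is_derive_minus; apply picard_derive.
    * intros t. apply Hexp.
    * intros t. apply Rle_trans with (1 := F_lipschitz _ _ _).
      apply Rle_trans with (1 := Rmult_le_compat_l K _ _ (Rlt_le _ _ K_pos) (IH t)).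
      apply Req_le. unfold c. simpl. field. lra.
    * rewrite !picard_at_0. ring.
  + rewrite Rmult_0_r, exp_0. unfold c in *. lra.
Qed.

Lemma picard_tail (n m : nat) (x : R) :
  Rabs (picard F w (n + m) x - picard F w n x)
    <= 2 * (M / K) * exp (2 * K * Rabs x) * ((1 / 2) ^ n - (1 / 2) ^ (n + m)).
Proof.
induction m as [|m IH].
- rewrite Nat.add_0_r, !Rminus_diag, Rabs_R0, Rmult_0_r. lra.
- rewrite Nat.add_succ_r.
  replace (picard F w (S (n + m)) x - picard F w n x) with
    ((picard F w (S (n + m)) x - picard F w (n + m) x)
     + (picard F w (n + m) x - picard F w n x)) by ring.
  apply Rle_trans with (1 := Rabs_triang _ _).
  assert (H := picard_step (n + m) x).
  replace ((1 / 2) ^ S (n + m)) with (1 / 2 * (1 / 2) ^ (n + m)) by reflexivity.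
  lra.
Qed.

Lemma picard_bound_nonneg (x : R) : 0 <= 2 * (M / K) * exp (2 * K * Rabs x).
Proof.
assert (HM := M_nonneg). assert (He := exp_pos (2 * K * Rabs x)).
apply Rmult_le_pos; [| lra]. assert (0 <= M / K) by (apply Rdiv_le_0_compat; lra). lra.
Qed.

Lemma picard_distance (n m : nat) (x : R) :
  Rabs (picard F w (n + m) x - picard F w n x)
    <= 2 * (M / K) * exp (2 * K * Rabs x) * (1 / 2) ^ n.
Proof.
apply Rle_trans with (1 := picard_tail n m x).
apply Rmult_le_compat_l; [apply picard_bound_nonneg |].
assert (0 <= (1 / 2) ^ (n + m)) by (apply pow_le; lra). lra.
Qed.

Lemma ode_solution_lim (x : R) :
  is_lim_seq (fun n => picard F w n x) (ode_solution F w x).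
Proof.
apply Lim_seq_correct', ex_lim_seq_cauchy_corr.
intros eps.
set (C := 2 * (M / K) * exp (2 * K * Rabs x)).
destruct (proj2 (is_lim_seq_spec _ _) (scaled_geometric_lim C) (pos_div_2 eps)) as [N HN].
exists N.
assert (P : forall n, (N <= n)%nat ->
          Rabs (picard F w n x - picard F w N x) < eps / 2).
{ intros n Hn. replace n with (N + (n - N))%nat by lia.
  apply Rle_lt_trans with (1 := picard_distance N (n - N) x).
  assert (H := HN N (Nat.le_refl N)). rewrite Rminus_0_r in H.
  apply Rle_lt_trans with (1 := Rle_abs _) (2 := H). }
intros n m Hn Hm.
replace (picard F w n x - picard F w m x) with
  ((picard F w n x - picard F w N x) - (picard F w m x - picard F w N x)) by ring.
apply Rle_lt_trans with (1 := Rabs_triang _ _). rewrite Rabs_Ropp.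
assert (A := P n Hn). assert (B := P m Hm). lra.
Qed.

Lemma ode_solution_at_0 : ode_solution F w 0 = w.
Proof.
unfold ode_solution. rewrite (Lim_seq_ext _ (fun _ => w)).
- now rewrite Lim_seq_const.
- apply picard_at_0.
Qed.

Lemma ode_solution_tail (n : nat) (x : R) :
  Rabs (ode_solution F w x - picard F w n x)
    <= 2 * (M / K) * exp (2 * K * Rabs x) * (1 / 2) ^ n.
Proof.
apply (lim_seq_abs_le (fun m => picard F w (n + m) x - picard F w n x)).
- intros m. apply picard_distance.
- apply is_lim_seq_minus'; [| apply is_lim_seq_const].
  apply (is_lim_seq_ext (fun m => picard F w (m + n) x)).
  + intros m. now rewrite Nat.add_comm.
  + apply (is_lim_seq_incr_n (fun m => picard F w m x)), ode_solution_lim.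
Qed.

Lemma picard_lipschitz (n : nat) (x y : R) :
  Rabs (picard F w n x - picard F w n y) <= M * Rabs (x - y).
Proof.
assert (HM := M_nonneg). destruct n as [|n].
- simpl. rewrite Rminus_diag, Rabs_R0. apply Rmult_le_pos; [lra | apply Rabs_pos].
- destruct (MVT_gen (picard F w (S n)) y x (fun t => F t (picard F w n t)))
    as [c [_ E]].
  + intros t _. apply picard_derive.
  + intros t _. apply continuity_pt_filterlim, picard_continuous.
  + rewrite E, Rabs_mult. apply Rmult_le_compat_r; [apply Rabs_pos | apply F_bounded].
Qed.

Lemma ode_solution_continuous (x : R) : continuous (ode_solution F w) x.
Proof.
assert (HM := M_nonneg).
assert (L : forall y, Rabs (ode_solution F w y - ode_solution F w x)
                      <= M * Rabs (y - x)).
{ intros y. apply (lim_seq_abs_le (fun n => picard F w n y - picard F w n x)).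
  - intros n. apply picard_lipschitz.
  - apply is_lim_seq_minus'; apply ode_solution_lim. }
apply filterlim_locally. intros eps.
assert (He : 0 < eps / (M + 1)) by (apply Rdiv_lt_0_compat; [apply cond_pos | lra]).
exists (mkposreal _ He). intros y Hy.
apply Rle_lt_trans with (1 := L y).
assert (Hy' : Rabs (y - x) < eps / (M + 1)) by exact Hy.
apply (Rmult_lt_compat_r (M + 1)) in Hy'; [| lra].
replace (eps / (M + 1) * (M + 1)) with (pos eps) in Hy' by (field; lra).
assert (Hp := Rabs_pos (y - x)). lra.
Qed.

(** The limit satisfies the integral equation, because the iterates converge both
to it and to the integral of [F] along it; the latter by the same weighted
estimate as in [picard_step]. *)
Theorem ode_solution_derive (x : R) :
  is_derive (ode_solution F w) x (F x (ode_solution F w x)).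
Proof.
set (th := ode_solution F w).
assert (Hc : forall t, continuous (fun t => F t (th t)) t)
  by apply F_continuous, ode_solution_continuous.
apply (is_derive_ext (fun x => w + RInt (fun t => F t (th t)) 0 x));
  [| now apply (is_derive_integral (fun t => F t (th t)))].
clear x. intros x.
set (C := M / K * exp (2 * K * Rabs x)).
assert (B : forall n, Rabs (w + RInt (fun t => F t (th t)) 0 x - picard F w (S n) x)
                      <= C * (1 / 2) ^ n).
{ intros n. set (c := M / K * (1 / 2) ^ n).
  assert (Hc0 : 0 <= c).
  { apply Rmult_le_pos; [apply Rdiv_le_0_compat; [apply M_nonneg | lra] |].
    apply pow_le; lra. }
  apply Rle_trans with (c * exp (2 * K * Rabs x) - c * exp (2 * K * 0)).
  - apply (abs_le_of_derive
             (fun x => w + RInt (fun t => F t (th t)) 0 x - picard F w (S n) x)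
             (fun x => F x (th x) - F x (picard F w n x))
             (fun t => c * exp (2 * K * t)) (fun t => c * (2 * K) * exp (2 * K * t))).
    + intros t. apply @is_derive_minus; [| apply picard_derive].
      now apply (is_derive_integral (fun t => F t (th t))).
    + intros t. auto_derive; [easy | ring].
    + intros t. apply Rle_trans with (1 := F_lipschitz _ _ _).
      apply Rle_trans with
        (1 := Rmult_le_compat_l K _ _ (Rlt_le _ _ K_pos) (ode_solution_tail n t)).
      apply Req_le. unfold c. field. lra.
    + rewrite picard_at_0, RInt_point. unfold zero; simpl. ring.
  - rewrite Rmult_0_r, exp_0. unfold C, c in *. lra. }
assert (L1 : is_lim_seq (fun n => picard F w (S n) x) (th x))
  by apply (is_lim_seq_incr_1 (fun n => picard F w n x)), ode_solution_lim.
assert (L2 : is_lim_seq (fun n => picard F w (S n) x)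
               (w + RInt (fun t => F t (th t)) 0 x)).
{ set (I := w + RInt (fun t => F t (th t)) 0 x) in *.
  apply (is_lim_seq_le_le (fun n => I - C * (1 / 2) ^ n) _
                          (fun n => I + C * (1 / 2) ^ n)).
  - intros n. assert (H := B n). apply Rabs_le_between in H. lra.
  - rewrite <- (Rminus_0_r I) at 1.
    apply is_lim_seq_minus'; [apply is_lim_seq_const | apply scaled_geometric_lim].
  - rewrite <- (Rplus_0_r I) at 1.
    apply is_lim_seq_plus'; [apply is_lim_seq_const | apply scaled_geometric_lim]. }
assert (E := is_lim_seq_unique _ _ L1). rewrite (is_lim_seq_unique _ _ L2) in E.
now injection E.
Qed.
End Picard.

(** * The Pruefer angle *)

Definition bounded_continuous (q : R -> R) (B : R) : Prop :=
  (forall t, continuous q t) /\ forall t, Rabs (q t) <= B.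

(** This is cos^2 u + q sin^2 u, written with a single trigonometric term. *)
Definition prufer_field (q : R -> R) (t u : R) : R := 1 + (q t - 1) * sin u ^ 2.

Definition prufer (q th : R -> R) : Prop :=
  forall t, is_derive th t (prufer_field q t (th t)).

Definition angle (q : R -> R) (w : R) : R -> R := ode_solution (prufer_field q) w.

Lemma bound_nonneg (q : R -> R) (B : R) : (forall t, Rabs (q t) <= B) -> 0 <= B.
Proof. intros H. apply Rle_trans with (2 := H 0), Rabs_pos. Qed.

Lemma Rabs_sin_le (x : R) : Rabs (sin x) <= Rabs x.
Proof.
assert (P : forall x, 0 <= x -> Rabs (sin x) <= x).
{ clear. intros x Hx. apply Rabs_le. split.
  - destruct (Rle_or_lt x 1) as [H | H].
    + assert (0 <= sin x) by (apply sin_ge_0; assert (H1 := PI2_1); lra). lra.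
    + assert (H1 := SIN_bound x). lra.
  - destruct Hx as [Hx | <-].
    + left. now apply sin_lt_x.
    + rewrite sin_0. lra. }
destruct (Rle_or_lt 0 x) as [H | H].
- rewrite (Rabs_right x) by lra. now apply P.
- rewrite (Rabs_left x) by lra. rewrite <- Rabs_Ropp, <- sin_neg. apply P. lra.
Qed.

Lemma sin_sq_lipschitz (u v : R) : Rabs (sin u ^ 2 - sin v ^ 2) <= Rabs (u - v).
Proof.
replace (sin u ^ 2 - sin v ^ 2) with (sin (u - v) * sin (u + v)).
- rewrite Rabs_mult. assert (H1 := Rabs_sin_le (u - v)).
  assert (H2 : Rabs (sin (u + v)) <= 1) by (apply Rabs_le, SIN_bound).
  assert (H3 := Rabs_pos (sin (u - v))). nra.
- rewrite sin_minus, sin_plus.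
  assert (H1 := sin2_cos2 u). assert (H2 := sin2_cos2 v). unfold Rsqr in *.
  replace (sin u ^ 2) with (sin u ^ 2 * (sin v * sin v + cos v * cos v))
    by (rewrite H2; ring).
  replace (sin v ^ 2) with (sin v ^ 2 * (sin u * sin u + cos u * cos u))
    by (rewrite H1; ring).
  ring.
Qed.

Lemma prufer_field_lipschitz (q : R -> R) (B : R) (t u v : R) :
  (forall t, Rabs (q t) <= B) ->
  Rabs (prufer_field q t u - prufer_field q t v) <= (B + 1) * Rabs (u - v).
Proof.
intros HB. unfold prufer_field.
replace (1 + (q t - 1) * sin u ^ 2 - (1 + (q t - 1) * sin v ^ 2))
  with ((q t - 1) * (sin u ^ 2 - sin v ^ 2)) by ring.
rewrite Rabs_mult. apply Rmult_le_compat; try apply Rabs_pos.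
- apply Rle_trans with (1 := Rabs_triang _ _).
  rewrite Rabs_Ropp, Rabs_R1. assert (H := HB t). lra.
- apply sin_sq_lipschitz.
Qed.

Lemma prufer_field_bounded (q : R -> R) (B : R) (t u : R) :
  (forall t, Rabs (q t) <= B) -> Rabs (prufer_field q t u) <= B + 2.
Proof.
intros HB. assert (H := HB t). apply Rabs_le_between in H. unfold prufer_field.
assert (H1 := SIN_bound u). assert (H2 : 0 <= sin u ^ 2 <= 1) by (split; nra).
apply Rabs_le. nra.
Qed.

Section Angle.
Variables (q : R -> R) (B w : R).
Hypothesis Hq : bounded_continuous q B.

Lemma prufer_field_continuous (u : R -> R) :
  (forall t, continuous u t) -> forall t, continuous (fun t => prufer_field q t (u t)) t.
Proof.
intros Hu t. unfold prufer_field.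
apply @continuous_plus; [apply @continuous_const |].
apply @continuous_mult.
- apply @continuous_minus; [apply Hq | apply @continuous_const].
- apply (continuous_comp u (fun z => sin z ^ 2)); [apply Hu |].
  apply (ex_derive_continuous (fun z : R => sin z ^ 2)). auto_derive. easy.
Qed.

Lemma angle_prufer : prufer q (angle q w).
Proof.
assert (HB := bound_nonneg q B (proj2 Hq)).
intros t. apply (ode_solution_derive (prufer_field q) (B + 2) (B + 1)).
- intros; now apply prufer_field_bounded, Hq.
- intros; now apply prufer_field_lipschitz, Hq.
- apply prufer_field_continuous.
- lra.
Qed.

Lemma angle_0 : angle q w 0 = w.
Proof. apply ode_solution_at_0. Qed.
End Angle.

(** The difference of a supersolution [psi] and a subsolution [phi] satisfies the
hypotheses of the barrier lemmas with K = B + 1. *)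
Section Comparison.
Variables (q : R -> R) (B x0 : R) (phi dphi psi dpsi : R -> R).
Hypothesis HB : forall t, Rabs (q t) <= B.
Hypothesis Hphi : forall t, is_derive phi t (dphi t).
Hypothesis Hpsi : forall t, is_derive psi t (dpsi t).
Hypothesis phi_sub : forall t, dphi t <= prufer_field q t (phi t).
Hypothesis psi_super : forall t, prufer_field q t (psi t) <= dpsi t.

Lemma sub_super_derive (t : R) :
  is_derive (fun t => psi t - phi t) t (dpsi t - dphi t).
Proof. apply @is_derive_minus; auto. Qed.

Lemma sub_super_bound (t : R) :
  - ((B + 1) * Rabs (psi t - phi t)) <= dpsi t - dphi t.
Proof.
assert (H := prufer_field_lipschitz q B t (psi t) (phi t) HB).
apply Rabs_le_between in H. assert (H1 := phi_sub t). assert (H2 := psi_super t). lra.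
Qed.

Lemma sub_super_le (x : R) : phi x0 <= psi x0 -> x0 <= x -> phi x <= psi x.
Proof.
intros H Hx. cut (0 <= psi x - phi x); [lra |].
apply (barrier_nonneg (B + 1) x0 _ _ sub_super_derive sub_super_bound); lra.
Qed.

Lemma sub_super_lt (x : R) : phi x0 < psi x0 -> x0 <= x -> phi x < psi x.
Proof.
intros H Hx. cut (0 < psi x - phi x); [lra |].
apply (barrier_pos (B + 1) x0 _ _ sub_super_derive sub_super_bound); lra.
Qed.

Lemma sub_super_stuck (x1 : R) :
  phi x0 <= psi x0 -> psi x1 <= phi x1 -> forall x, x0 <= x <= x1 -> psi x - phi x = 0.
Proof.
intros H H1.
apply (barrier_stuck (B + 1) x0 x1 _ _ sub_super_derive sub_super_bound); lra.
Qed.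
End Comparison.

Lemma prufer_le (q th1 th2 : R -> R) (B x0 x : R) :
  (forall t, Rabs (q t) <= B) -> prufer q th1 -> prufer q th2 ->
  th1 x0 <= th2 x0 -> x0 <= x -> th1 x <= th2 x.
Proof.
intros HB H1 H2. apply (sub_super_le q B x0 _ _ _ _ HB H1 H2); intros; apply Rle_refl.
Qed.

Lemma prufer_lt (q th1 th2 : R -> R) (B x0 x : R) :
  (forall t, Rabs (q t) <= B) -> prufer q th1 -> prufer q th2 ->
  th1 x0 < th2 x0 -> x0 <= x -> th1 x < th2 x.
Proof.
intros HB H1 H2. apply (sub_super_lt q B x0 _ _ _ _ HB H1 H2); intros; apply Rle_refl.
Qed.

(** The field is even and pi-periodic in the angle. *)
Lemma prufer_reflect (q th : R -> R) (c s : R) :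
  prufer q th -> sin s = 0 ->
  prufer (fun x => q (c - x)) (fun x => s - th (c - x)).
Proof.
intros H Hs t. eapply is_derive_cast.
- auto_derive; [eexists; apply H |]. reflexivity.
- rewrite (is_derive_unique (fun t : R => th t) _ _ (H (c + - t))).
  unfold prufer_field, Rminus. rewrite sin_plus, cos_neg, sin_neg, Hs.
  assert (E := sin2_cos2 s). unfold Rsqr in E. rewrite Hs in E.
  replace ((0 * cos (th (c + - t)) + cos s * - sin (th (c + - t))) ^ 2)
    with ((0 * 0 + cos s * cos s) * sin (th (c + - t)) ^ 2) by ring.
  rewrite E. ring.
Qed.

Lemma sin_IZR_PI (k : Z) : sin (IZR k * PI) = 0.
Proof. apply sin_eq_0_1. now exists k. Qed.

Lemma prufer_shift (q th : R -> R) (k : Z) :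
  prufer q th -> prufer q (fun x => th x + IZR k * PI).
Proof.
intros H t. eapply is_derive_cast.
- apply @is_derive_plus; [apply H | apply @is_derive_const].
- unfold prufer_field, plus, zero; simpl.
  assert (E := sin2_cos2 (IZR k * PI)). unfold Rsqr in E.
  rewrite sin_plus, !sin_IZR_PI in *.
  replace ((sin (th t) * cos (IZR k * PI) + cos (th t) * 0)
     * ((sin (th t) * cos (IZR k * PI) + cos (th t) * 0) * 1))
    with (sin (th t) ^ 2 * (0 * 0 + cos (IZR k * PI) * cos (IZR k * PI))) by ring.
  rewrite E. ring.
Qed.

(** Multiples of pi are strict subsolutions, the field being 1 there, so an angle
passes each of them at most once, upwards. *)
Lemma prufer_crosses (q th : R -> R) (B x0 x : R) (k : Z) :
  (forall t, Rabs (q t) <= B) -> prufer q th ->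
  IZR k * PI <= th x0 -> x0 < x -> IZR k * PI < th x.
Proof.
intros HB H H0 Hx.
assert (F : forall t, prufer_field q t (IZR k * PI) = 1).
{ intros t. unfold prufer_field. rewrite sin_IZR_PI. ring. }
destruct (Rlt_or_le (IZR k * PI) (th x)) as [| Hle]; [easy | exfalso].
assert (S := sub_super_stuck q B x0 (fun _ => IZR k * PI) (fun _ => 0) th _ HB
  (fun t => is_derive_const _ t) H
  ltac:(intros t; cbv beta; rewrite F; lra) (fun t => Rle_refl _) x H0 Hle).
assert (C : forall t, x0 <= t <= x -> th t = IZR k * PI).
{ intros t Ht. assert (E := S t Ht). cbv beta in E. lra. }
assert (E := derive_zero_on th x0 x ((x0 + x) / 2) _ _ (H _) ltac:(lra) C).
rewrite C, F in E by lra. lra.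
Qed.

(** Comparison of the angles of [q] and of [q + delta], the effect of raising the
eigenvalue parameter by [delta]. *)
Section Monotone.
Variables (q : R -> R) (B delta x0 : R) (th1 th2 : R -> R).
Hypothesis HB : forall t, Rabs (q t) <= B.
Hypothesis H1 : prufer q th1.
Hypothesis H2 : prufer (fun t => q t + delta) th2.
Hypothesis H0 : th1 x0 = th2 x0.

Lemma prufer_field_plus (t u : R) :
  prufer_field (fun t => q t + delta) t u = prufer_field q t u + delta * sin u ^ 2.
Proof. unfold prufer_field. ring. Qed.

Lemma prufer_mono_super : 0 <= delta ->
  forall t, prufer_field q t (th2 t) <= prufer_field (fun t => q t + delta) t (th2 t).
Proof.
intros Hd t. rewrite prufer_field_plus. assert (0 <= sin (th2 t) ^ 2) by nra. nra.
Qed.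

Lemma prufer_mono (x : R) : 0 <= delta -> x0 <= x -> th1 x <= th2 x.
Proof.
intros Hd. apply (sub_super_le q B x0 _ _ _ _ HB H1 H2).
- intros; apply Rle_refl.
- now apply prufer_mono_super.
- lra.
Qed.

(** If the two angles met at [x] they would coincide before it, so that
delta sin^2 th2 = 0 there. But an angle never stays at a zero of the sine. *)
Lemma prufer_strict_mono (x : R) : 0 < delta -> x0 < x -> th1 x < th2 x.
Proof.
intros Hd Hx. destruct (Rlt_or_le (th1 x) (th2 x)) as [| Hle]; [easy | exfalso].
assert (S := sub_super_stuck q B x0 _ _ _ _ HB H1 H2 (fun t => Rle_refl _)
  (prufer_mono_super (Rlt_le _ _ Hd)) x ltac:(lra) Hle).
assert (Z : forall t, x0 < t < x -> sin (th2 t) = 0).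
{ intros t Ht.
  assert (E := derive_zero_on _ x0 x t _ _
    (sub_super_derive _ _ _ _ H1 H2 t) Ht S).
  assert (E2 := S t ltac:(lra)). cbv beta in E, E2.
  replace (th1 t) with (th2 t) in E by lra.
  rewrite prufer_field_plus in E.
  assert (E3 : delta * sin (th2 t) ^ 2 = 0) by lra.
  apply Rmult_integral in E3. destruct E3 as [| E3]; [lra |].
  replace (sin (th2 t) ^ 2) with (sin (th2 t) * sin (th2 t)) in E3 by ring.
  apply Rmult_integral in E3. tauto. }
set (m := (x0 + x) / 2).
assert (D : is_derive (fun t => sin (th2 t)) m
          (prufer_field (fun t => q t + delta) m (th2 m) * cos (th2 m))).
{ apply (is_derive_comp sin th2); [apply is_derive_sin | apply H2]. }
assert (E := derive_zero_on _ ((x0 + m) / 2) ((m + x) / 2) m _ 0 D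
   ltac:(unfold m; lra) ltac:(intros t Ht; apply Z; unfold m in *; lra)).
unfold prufer_field in E. rewrite Z in E by (unfold m; lra).
assert (E2 := sin2_cos2 (th2 m)). unfold Rsqr in E2.
rewrite Z in E2 by (unfold m; lra).
replace (cos (th2 m)) with 0 in E2 by lra. lra.
Qed.

Lemma prufer_dependence (x : R) : 0 <= delta -> x0 <= x ->
  th2 x - th1 x <= delta * (x - x0) * exp ((B + 1) * (x - x0)).
Proof.
intros Hd Hx. assert (HB0 := bound_nonneg q B HB).
set (K := B + 1). set (D := fun t => th2 t - th1 t).
(* D' <= K * D + delta, so D decays against delta * t once discounted at rate K *)
assert (M : delta * x0 - exp (K * x0) * (D x0 * exp (- K * x0))
         <= delta * x - exp (K * x0) * (D x * exp (- K * x))).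
{ apply derive_nonneg_le with
    (g := fun t => delta * t - exp (K * x0) * (D t * exp (- K * t)))
    (dg := fun t => delta - exp (K * x0) *
       ((prufer_field (fun t => q t + delta) t (th2 t) - prufer_field q t (th1 t)
         + - K * D t) * exp (- K * t))); [| | easy].
  - intros t _. apply @is_derive_minus.
    + auto_derive; [easy | ring].
    + apply is_derive_scal, (is_derive_mult_exp D).
      apply (sub_super_derive _ _ _ _ H1 H2).
  - intros t Ht. assert (A := prufer_mono t Hd (proj1 Ht)).
    rewrite prufer_field_plus.
    assert (L := prufer_field_lipschitz q B t (th2 t) (th1 t) HB).
    rewrite (Rabs_right (th2 t - th1 t)) in L by lra. apply Rabs_le_between in L.
    assert (Hs := SIN_bound (th2 t)). assert (Hs2 : sin (th2 t) ^ 2 <= 1) by nra.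
    set (X := prufer_field q t (th2 t) + delta * sin (th2 t) ^ 2
              - prufer_field q t (th1 t) + - K * D t).
    assert (HX : X <= delta).
    { assert (delta * sin (th2 t) ^ 2 <= delta * 1) by now apply Rmult_le_compat_l.
      unfold X, K, D. lra. }
    replace (exp (K * x0) * (X * exp (- K * t))) with (X * exp (- (K * (t - x0)))).
    + assert (He : exp (- (K * (t - x0))) <= exp 0).
      { apply exp_le_compat. assert (0 <= K * (t - x0)); [| lra].
        apply Rmult_le_pos; unfold K; lra. }
      rewrite exp_0 in He. assert (He0 := exp_pos (- (K * (t - x0)))). nra.
    + replace (- (K * (t - x0))) with (K * x0 + - K * t) by ring.
      rewrite exp_plus. ring. }
unfold D in M at 1. rewrite H0, Rminus_diag in M.
replace (exp (K * x0) * (D x * exp (- K * x))) with (D x * / exp (K * (x - x0))) in M.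
- assert (He := exp_pos (K * (x - x0))).
  assert (M2 : D x * / exp (K * (x - x0)) <= delta * (x - x0)) by lra.
  apply (Rmult_le_compat_r _ _ _ (Rlt_le _ _ He)) in M2.
  rewrite Rmult_assoc, Rinv_l in M2; unfold D in *; lra.
- rewrite <- exp_Ropp. replace (- (K * (x - x0))) with (K * x0 + - K * x) by ring.
  rewrite exp_plus. ring.
Qed.
End Monotone.

(** * The linear equation *)

(** The equation y'' = - q y as a first-order system, with the derivative carried
along. *)
Definition schrodinger (q y dy : R -> R) : Prop :=
  forall t, is_derive y t (dy t) /\ is_derive dy t (- (q t * y t)).

Lemma schrodinger_combination (q y1 dy1 y2 dy2 : R -> R) (c1 c2 : R) :
  schrodinger q y1 dy1 -> schrodinger q y2 dy2 ->
  schrodinger q (fun t => c1 * y1 t + c2 * y2 t) (fun t => c1 * dy1 t + c2 * dy2 t).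
Proof.
intros H1 H2 t. destruct (H1 t) as [A1 A2]. destruct (H2 t) as [B1 B2]. split.
- auto_derive; [split; [eexists; apply A1 | split; [eexists; apply B1 | easy]] |].
  rewrite (is_derive_unique (fun t : R => y1 t) _ _ A1),
          (is_derive_unique (fun t : R => y2 t) _ _ B1). ring.
- auto_derive; [split; [eexists; apply A2 | split; [eexists; apply B2 | easy]] |].
  rewrite (is_derive_unique (fun t : R => dy1 t) _ _ A2),
          (is_derive_unique (fun t : R => dy2 t) _ _ B2). ring.
Qed.

Lemma schrodinger_reflect (q y dy : R -> R) (c : R) :
  schrodinger q y dy ->
  schrodinger (fun t => q (c - t)) (fun t => y (c - t)) (fun t => - dy (c - t)).
Proof.
intros H t. destruct (H (c + - t)) as [A1 A2]. split.
- auto_derive; [eexists; apply A1 |].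
  rewrite (is_derive_unique (fun t : R => y t) _ _ A1). unfold Rminus. ring.
- auto_derive; [eexists; apply A2 |].
  rewrite (is_derive_unique (fun t : R => dy t) _ _ A2). unfold Rminus. ring.
Qed.

Lemma schrodinger_ext (q q' y dy : R -> R) :
  (forall t, q t = q' t) -> schrodinger q y dy -> schrodinger q' y dy.
Proof. intros E H t. rewrite <- E. apply H. Qed.

(** The energy y^2 + y'^2 has logarithmic derivative at most 1 + |q|; it is made
into a barrier by a change of sign, and the reflection covers the past. *)
Lemma schrodinger_zero (q y dy : R -> R) (B x0 : R) :
  (forall t, Rabs (q t) <= B) -> schrodinger q y dy -> y x0 = 0 -> dy x0 = 0 ->
  forall x, y x = 0 /\ dy x = 0.
Proof.
assert (P : forall q y dy : R -> R, forall x0, (forall t, Rabs (q t) <= B) ->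
  schrodinger q y dy -> y x0 = 0 -> dy x0 = 0 ->
  forall x, x0 <= x -> y x = 0 /\ dy x = 0).
{ clear. intros q y dy x0 HB H Hy Hdy x Hx.
  assert (N : 0 <= - (y x ^ 2 + dy x ^ 2)).
  { apply (barrier_nonneg (B + 1) x0 (fun t => - (y t ^ 2 + dy t ^ 2))
            (fun t => - (2 * (1 - q t) * y t * dy t))); [| | | easy].
    - intros t. destruct (H t) as [A1 A2].
      auto_derive; [split; [eexists; apply A1 | split; [eexists; apply A2 | easy]] |].
      rewrite (is_derive_unique (fun t : R => y t) _ _ A1),
              (is_derive_unique (fun t : R => dy t) _ _ A2). ring.
    - intros t. assert (Hq := HB t). apply Rabs_le_between in Hq.
      rewrite Rabs_Ropp, Rabs_right by nra.
      assert (0 <= (y t - dy t) ^ 2) by apply pow2_ge_0.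
      assert (0 <= (y t + dy t) ^ 2) by apply pow2_ge_0.
      set (p := y t) in *. set (r := dy t) in *.
      assert (0 <= (B + 1 - (1 - q t)) * (p + r) ^ 2) by (apply Rmult_le_pos; lra).
      assert (0 <= (B + 1 + (1 - q t)) * (p - r) ^ 2) by (apply Rmult_le_pos; lra).
      lra.
    - rewrite Hy, Hdy. lra. }
  split; nra. }
intros HB H Hy Hdy x. destruct (Rle_or_lt x0 x) as [Hx | Hx].
- now apply (P q y dy x0).
- destruct (P _ _ _ 0 (fun t => HB (x0 - t)) (schrodinger_reflect q y dy x0 H)
     ltac:(cbv beta; rewrite Rminus_0_r; exact Hy)
     ltac:(cbv beta; rewrite Rminus_0_r, Hdy; ring) (x0 - x) ltac:(lra)) as [E1 E2].
  cbv beta in E1, E2. replace (x0 - (x0 - x)) with x in * by ring. split; lra.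
Qed.

Lemma schrodinger_unique (q y1 dy1 y2 dy2 : R -> R) (B x0 : R) :
  (forall t, Rabs (q t) <= B) -> schrodinger q y1 dy1 -> schrodinger q y2 dy2 ->
  y1 x0 = y2 x0 -> dy1 x0 = dy2 x0 -> forall x, y1 x = y2 x /\ dy1 x = dy2 x.
Proof.
intros HB H1 H2 E1 E2 x.
destruct (schrodinger_zero q _ _ B x0 HB
  (schrodinger_combination q _ _ _ _ 1 (-1) H1 H2)) with (x := x) as [A1 A2]; lra.
Qed.

(** The solution of r' = (1 - q) (sin th) (cos th) r, the radial half of the polar
form of the system. *)
Definition amplitude (q : R -> R) (w x : R) : R :=
  exp (RInt (fun t => (1 - q t) * (sin (angle q w t) * cos (angle q w t))) 0 x).
Definition wave (q : R -> R) (w x : R) : R := amplitude q w x * sin (angle q w x).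
Definition dwave (q : R -> R) (w x : R) : R := amplitude q w x * cos (angle q w x).

Lemma amplitude_pos (q : R -> R) (w x : R) : 0 < amplitude q w x.
Proof. apply exp_pos. Qed.

Lemma wave_0 (q : R -> R) (w : R) : wave q w 0 = sin w.
Proof.
unfold wave, amplitude. rewrite RInt_point, angle_0. unfold zero; simpl.
rewrite exp_0. ring.
Qed.

Lemma dwave_0 (q : R -> R) (w : R) : dwave q w 0 = cos w.
Proof.
unfold dwave, amplitude. rewrite RInt_point, angle_0. unfold zero; simpl.
rewrite exp_0. ring.
Qed.

Lemma wave_schrodinger (q : R -> R) (B w : R) :
  bounded_continuous q B -> schrodinger q (wave q w) (dwave q w).
Proof.
intros Hq.
assert (Hth := angle_prufer q B w Hq). set (th := angle q w) in *.
set (g := fun t => (1 - q t) * (sin (th t) * cos (th t))).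
assert (Hg : forall t, continuous g t).
{ intros t. apply @continuous_mult.
  - apply @continuous_minus; [apply @continuous_const | apply Hq].
  - apply (continuous_comp th (fun z => sin z * cos z)).
    + apply (is_derive_continuous _ _ _ (Hth t)).
    + apply (ex_derive_continuous (fun z : R => sin z * cos z)). auto_derive. easy. }
assert (Ha : forall t, is_derive (amplitude q w) t (g t * amplitude q w t)).
{ intros t. eapply is_derive_cast.
  - apply (is_derive_comp exp (fun x => RInt g 0 x)); [apply is_derive_exp |].
    apply (is_derive_ext (fun x => 0 + RInt g 0 x)); [intros; apply Rplus_0_l |].
    apply is_derive_integral, Hg.
  - reflexivity. }
unfold wave, dwave. fold th. set (r := amplitude q w) in *.
intros t. assert (Ea := Ha t). assert (Et := Hth t). unfold prufer_field in Et.
assert (E := sin2_cos2 (th t)). unfold Rsqr in E. split.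
- auto_derive; [split; [eexists; apply Ea | split; [eexists; apply Et | easy]] |].
  rewrite (is_derive_unique (fun t : R => r t) _ _ Ea),
          (is_derive_unique (fun t : R => th t) _ _ Et). unfold g.
  ring_simplify.
  replace (sin (th t) ^ 2) with (1 - cos (th t) ^ 2) by (simpl; lra). ring.
- auto_derive; [split; [eexists; apply Ea | split; [eexists; apply Et | easy]] |].
  rewrite (is_derive_unique (fun t : R => r t) _ _ Ea),
          (is_derive_unique (fun t : R => th t) _ _ Et). unfold g.
  replace (1 * ((1 - q t) * (sin (th t) * cos (th t)) * r t) * cos (th t))
    with (r t * sin (th t) * (1 - q t) * (cos (th t) * cos (th t))) by ring.
  replace (cos (th t) * cos (th t)) with (1 - sin (th t) ^ 2) by (simpl; lra). ring.
Qed.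

(** Unlike [ex_derive_n], this carries the successive derivatives as functions,
which makes closure under products an immediate induction. *)
Fixpoint derivable_times (n : nat) (f : R -> R) : Prop :=
  match n with
  | O => True
  | S n => exists f', (forall x, is_derive f x (f' x)) /\ derivable_times n f'
  end.

Lemma derivable_times_ex_derive_n (n : nat) (f : R -> R) (x : R) :
  derivable_times n f -> ex_derive_n f n x.
Proof.
revert f. induction n as [|n IH]; intros f; [easy |].
intros [f' [Hf Hf']].
assert (E : forall m x, Derive_n f (S m) x = Derive_n f' m x).
{ induction m as [|m IHm]; intros z.
  - apply is_derive_unique, Hf.
  - change (Derive (Derive_n f (S m)) z = Derive (Derive_n f' m) z).
    now apply Derive_ext. }
destruct n as [|n].
- eexists. apply Hf.
- change (ex_derive (Derive_n f (S n)) x).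
  apply ex_derive_ext with (Derive_n f' n); [intros; now rewrite E |].
  apply (IH f' Hf').
Qed.

Lemma smooth_derivable_times (n : nat) (f : R -> R) : smooth f -> derivable_times n f.
Proof.
revert f. induction n as [|n IH]; intros f Hf; [easy |].
exists (Derive f). split.
- intros x. apply Derive_correct. apply (Hf 1%nat).
- apply IH. intros m x. assert (H := Hf (S m) x).
  destruct m as [|m]; [easy |].
  change (ex_derive (Derive_n f (S m)) x) in H || idtac.
  apply ex_derive_ext with (Derive_n f (S m)).
  + intros t. replace (S m) with (m + 1)%nat by lia.
    symmetry. apply (Derive_n_comp f m 1 t).
  + exact H.
Qed.

Lemma smooth_iff (f : R -> R) : smooth f <-> forall n, derivable_times n f.
Proof.
split.
- intros H n. now apply smooth_derivable_times.
- intros H n x. apply derivable_times_ex_derive_n, H.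
Qed.

Lemma derivable_times_pred (n : nat) (f : R -> R) :
  derivable_times (S n) f -> derivable_times n f.
Proof.
revert f. induction n as [|n IH]; intros f; [easy |].
intros [f' [Hf Hf']]. exists f'. split; [easy |]. now apply IH.
Qed.

Lemma derivable_times_plus (n : nat) (f g : R -> R) :
  derivable_times n f -> derivable_times n g -> derivable_times n (fun x => f x + g x).
Proof.
revert f g. induction n as [|n IH]; intros f g; [easy |].
intros [f' [Hf Hf']] [g' [Hg Hg']]. exists (fun x => f' x + g' x). split.
- intros x. now apply @is_derive_plus.
- now apply IH.
Qed.

Lemma derivable_times_mult (n : nat) (f g : R -> R) :
  derivable_times n f -> derivable_times n g -> derivable_times n (fun x => f x * g x).
Proof.
revert f g. induction n as [|n IH]; intros f g; [easy |].
intros Hf Hg. assert (Hf0 := derivable_times_pred n f Hf).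
assert (Hg0 := derivable_times_pred n g Hg).
destruct Hf as [f' [Hf Hf']], Hg as [g' [Hg Hg']].
exists (fun x => f' x * g x + f x * g' x). split.
- intros x. apply @is_derive_mult; auto. intros; apply Rmult_comm.
- now apply derivable_times_plus; apply IH.
Qed.

Lemma derivable_times_const (n : nat) (c : R) : derivable_times n (fun _ => c).
Proof.
revert c. induction n as [|n IH]; intros c; [easy |].
exists (fun _ => 0). split; [intros x; apply @is_derive_const | apply IH].
Qed.

Lemma derivable_times_ext (n : nat) (f g : R -> R) :
  (forall x, f x = g x) -> derivable_times n f -> derivable_times n g.
Proof.
destruct n as [|n]; [easy |]. intros E [f' [Hf Hf']]. exists f'. split; [| easy].
intros x. now apply (is_derive_ext f).
Qed.

(** Bootstrapping: each derivative of [y] and [dy] is a polynomial in [q], [y] and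
[dy], so n derivatives of the pair give one more. *)
Lemma schrodinger_smooth (q y dy : R -> R) :
  smooth q -> schrodinger q y dy -> smooth y.
Proof.
intros Hq H. rewrite smooth_iff in Hq. apply smooth_iff.
assert (P : forall n, derivable_times n y /\ derivable_times n dy).
{ induction n as [|n [IHy IHdy]]; [easy |]. split.
  - exists dy. split; [intros x; apply H | easy].
  - exists (fun t => - (q t * y t)). split; [intros x; apply H |].
    apply derivable_times_ext with (fun t => (-1) * (q t * y t)); [intros; ring |].
    apply (derivable_times_mult n (fun _ => -1)); [apply derivable_times_const |].
    now apply derivable_times_mult. }
intros n. apply P.
Qed.

(** * Periodic functions and dimensions *)

Lemma periodic_IZR (a : R) (f : R -> R) :
  (forall x, f x = f (x + a)) -> forall (n : Z) x, f (x + IZR n * a) = f x.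
Proof.
intros Hf.
assert (P : forall (n : nat) x, f (x + INR n * a) = f x).
{ induction n as [|n IH]; intros x.
  - f_equal. simpl. ring.
  - rewrite S_INR, <- (IH x), (Hf (x + INR n * a)). f_equal. ring. }
intros n x. destruct (Z.le_gt_cases 0 n) as [Hn | Hn].
- rewrite <- (Z2Nat.id n Hn), <- INR_IZR_INZ. apply P.
- rewrite <- (P (Z.to_nat (- n)) (x + IZR n * a)). f_equal.
  rewrite INR_IZR_INZ, Z2Nat.id by lia. rewrite opp_IZR. ring.
Qed.

Lemma periodic_bounded (a : R) (f : R -> R) :
  0 < a -> (forall x, continuous f x) -> (forall x, f x = f (x + a)) ->
  exists B, forall x, Rabs (f x) <= B.
Proof.
intros Ha Hc Hf.
destruct (continuity_ab_maj (fun x => Rabs (f x)) 0 a (Rlt_le _ _ Ha)) as [m [Hm _]].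
- intros c _. apply continuity_pt_filterlim.
  apply (continuous_comp f Rabs); [apply Hc | apply @continuous_Rabs].
- exists (Rabs (f m)). intros x.
  rewrite <- (periodic_IZR a f Hf (- Int_part (x / a)) x).
  apply Hm. rewrite opp_IZR.
  destruct (base_Int_part (x / a)) as [H1 H2].
  assert (E : x = x / a * a) by (field; lra).
  split.
  + apply (Rmult_le_compat_r a) in H1; lra.
  + assert (H3 : x / a - IZR (Int_part (x / a)) <= 1) by lra.
    apply (Rmult_le_compat_r a) in H3; lra.
Qed.

Lemma lincomb_zeros (n : nat) (b : list (R -> R)) (x : R) : lincomb (repeat 0 n) b x = 0.
Proof.
unfold lincomb. revert b. induction n as [|n IH]; intros [|g b]; simpl; try easy.
rewrite IH. ring.
Qed.

Lemma has_dim_le_1 (E : (R -> R) -> Prop) (u : (R -> R) -> R) (g : R -> R) (n : nat) :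
  (forall f, E f -> forall x, f x = u f * g x) -> has_dim E n -> (n <= 1)%nat.
Proof.
intros Hu [b [<- [Hb [Hi _]]]].
destruct b as [| b1 [| b2 b]]; simpl; try lia. exfalso.
assert (D1 := Hu b1 (Hb b1 ltac:(simpl; tauto))).
assert (D2 := Hu b2 (Hb b2 ltac:(simpl; tauto))).
assert (F : forall k1 k2, (forall x, k1 * b1 x + k2 * b2 x = 0) -> k1 = 0 /\ k2 = 0).
{ intros k1 k2 H.
  assert (T := Hi (k1 :: k2 :: repeat 0 (length b)) ltac:(simpl; now rewrite repeat_length)).
  split; apply T; simpl; auto; intros x; unfold lincomb; simpl;
  change (k1 * b1 x + (k2 * b2 x + lincomb (repeat 0 (length b)) b x) = 0);
  rewrite lincomb_zeros; assert (Hx := H x); lra. }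
destruct (F (u b2) (- u b1)) as [_ F1].
{ intros x. rewrite D1, D2. ring. }
destruct (F 1 0) as [F2 _]; [| lra].
intros x. rewrite D1. replace (u b1) with 0 by lra. ring.
Qed.

(** Three vectors of a plane are dependent. The coefficients are the
two-by-two minors of the coordinates; should the minor of the first two vectors
vanish, those two are proportional. *)
Lemma has_dim_le_2 (E : (R -> R) -> Prop) (u v : (R -> R) -> R) (g h : R -> R) (n : nat) :
  (forall f, E f -> forall x, f x = u f * g x + v f * h x) ->
  has_dim E n -> (n <= 2)%nat.
Proof.
intros Hu [b [<- [Hb [Hi _]]]].
destruct b as [| b1 [| b2 [| b3 b]]]; simpl; try lia. exfalso.
assert (D1 := Hu b1 (Hb b1 ltac:(simpl; tauto))).
assert (D2 := Hu b2 (Hb b2 ltac:(simpl; tauto))).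
assert (D3 := Hu b3 (Hb b3 ltac:(simpl; tauto))).
assert (F : forall k1 k2 k3, (forall x, k1 * b1 x + k2 * b2 x + k3 * b3 x = 0) ->
  k1 = 0 /\ k2 = 0 /\ k3 = 0).
{ intros k1 k2 k3 H.
  assert (T := Hi (k1 :: k2 :: k3 :: repeat 0 (length b))
     ltac:(simpl; now rewrite repeat_length)).
  repeat split; apply T; simpl; auto; intros x; unfold lincomb; simpl;
  change (k1 * b1 x + (k2 * b2 x + (k3 * b3 x
    + lincomb (repeat 0 (length b)) b x)) = 0);
  rewrite lincomb_zeros; assert (Hx := H x); lra. }
set (x1 := u b1) in *. set (x2 := u b2) in *. set (x3 := u b3) in *.
set (y1 := v b1) in *. set (y2 := v b2) in *. set (y3 := v b3) in *.
destruct (F (x2 * y3 - x3 * y2) (x3 * y1 - x1 * y3) (x1 * y2 - x2 * y1)) as [_ [_ F3]].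
{ intros x. rewrite D1, D2, D3. ring. }
destruct (F x2 (- x1) 0) as [_ [F1 _]].
{ intros x. rewrite D1, D2. replace (_ + _) with (- (x1 * y2 - x2 * y1) * h x) by ring.
  rewrite F3. ring. }
destruct (F y2 (- y1) 0) as [_ [F2 _]].
{ intros x. rewrite D1, D2. replace (_ + _) with ((x1 * y2 - x2 * y1) * g x) by ring.
  rewrite F3. ring. }
destruct (F 1 0 0) as [F4 _]; [| lra].
intros x. rewrite D1. replace x1 with 0 by lra. replace y1 with 0 by lra. ring.
Qed.

Lemma has_dim_ge_1 (E : (R -> R) -> Prop) (g : R -> R) (x : R) (n : nat) :
  E g -> g x <> 0 -> has_dim E n -> (1 <= n)%nat.
Proof.
intros Hg Hx [b [<- [_ [_ Hs]]]]. destruct b as [| b1 b]; [exfalso | simpl; lia].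
destruct (Hs g Hg) as [[| c k] [_ E1]]; apply Hx; now rewrite E1.
Qed.

Lemma has_dim_ge_2 (E : (R -> R) -> Prop) (g h : R -> R) (x0 x1 : R) (n : nat) :
  E g -> E h -> g x0 <> 0 -> h x0 = 0 -> h x1 <> 0 -> has_dim E n -> (2 <= n)%nat.
Proof.
intros Hg Hh Hg0 Hh0 Hh1 Hn. assert (H1 := has_dim_ge_1 E g x0 n Hg Hg0 Hn).
destruct Hn as [b [<- [_ [_ Hs]]]].
destruct b as [| b1 [| b2 b]]; simpl in *; [lia | exfalso | lia].
destruct (Hs g Hg) as [[| kg [| ]] [L1 E1]]; try discriminate.
destruct (Hs h Hh) as [[| kh [| ]] [L2 E2]]; try discriminate.
unfold lincomb in E1, E2. simpl in E1, E2.
rewrite E1 in Hg0. rewrite E2 in Hh0, Hh1.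
assert (Hb : b1 x0 <> 0) by (intros Z; apply Hg0; rewrite Z; ring).
assert (Hk : kh * b1 x0 = 0) by lra.
apply Rmult_integral in Hk. destruct Hk as [-> | Hk]; [apply Hh1; ring | easy].
Qed.

(** * Solutions of Hill's equation with an even potential *)

Definition cosine_like (q : R -> R) : R -> R := wave q (PI / 2).
Definition sine_like (q : R -> R) : R -> R := wave q 0.

Definition shifted (V : R -> R) (lam t : R) : R := V t + lam.

Section Hill.
Variables (a : R) (V : R -> R) (B : R).
Hypothesis a_pos : 0 < a.
Hypothesis V_Fp : Fp a V.
Hypothesis V_even : forall x, V x = V (- x).
Hypothesis V_bound : forall x, Rabs (V x) <= B.

Lemma shifted_bounded_continuous (lam : R) :
  bounded_continuous (shifted V lam) (B + Rabs lam).
Proof.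
split; intros t; unfold shifted.
- apply @continuous_plus; [| apply @continuous_const].
  apply (ex_derive_continuous V). apply (proj1 V_Fp 1%nat).
- apply Rle_trans with (1 := Rabs_triang _ _). assert (H := V_bound t). lra.
Qed.

Lemma shifted_bound (lam t : R) : Rabs (shifted V lam t) <= B + Rabs lam.
Proof. apply shifted_bounded_continuous. Qed.

Lemma shifted_smooth (lam : R) : smooth (shifted V lam).
Proof.
apply smooth_iff. intros n. apply (derivable_times_plus n V (fun _ => lam)).
- apply smooth_iff, V_Fp.
- apply derivable_times_const.
Qed.

Lemma shifted_even (lam t : R) : shifted V lam (0 - t) = shifted V lam t.
Proof. unfold shifted. rewrite (V_even t). do 2 f_equal. ring. Qed.

Lemma shifted_reflect (lam t : R) : shifted V lam (a - t) = shifted V lam t.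
Proof.
rewrite <- shifted_even. unfold shifted. rewrite (proj2 V_Fp (0 - (a - t))).
do 2 f_equal. ring.
Qed.

Lemma schrodinger_reflect_0 (lam : R) (y dy : R -> R) :
  schrodinger (shifted V lam) y dy ->
  schrodinger (shifted V lam) (fun t => y (0 - t)) (fun t => - dy (0 - t)).
Proof.
intros H. apply (schrodinger_ext (fun t => shifted V lam (0 - t))).
- apply shifted_even.
- now apply schrodinger_reflect.
Qed.

Lemma schrodinger_reflect_a (lam : R) (y dy : R -> R) :
  schrodinger (shifted V lam) y dy ->
  schrodinger (shifted V lam) (fun t => y (a - t)) (fun t => - dy (a - t)).
Proof.
intros H. apply (schrodinger_ext (fun t => shifted V lam (a - t))).
- apply shifted_reflect.
- now apply schrodinger_reflect.
Qed.

Lemma eigenspace_schrodinger (lam : R) (f : R -> R) :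
  eigenspace a V lam f -> schrodinger (shifted V lam) f (Derive f).
Proof.
intros [[Hs _] HL] t. split.
- apply Derive_correct, (Hs 1%nat).
- assert (H := HL t). unfold Lop in H.
  replace (- (shifted V lam t * f t)) with (Derive_n f 2 t) by (unfold shifted; lra).
  apply Derive_correct, (Hs 2%nat).
Qed.

Lemma schrodinger_eigenspace (lam : R) (f df : R -> R) :
  schrodinger (shifted V lam) f df -> (forall x, f x = f (x + a)) ->
  eigenspace a V lam f.
Proof.
intros H Hp. split; [split; [| easy] |].
- apply (schrodinger_smooth _ _ _ (shifted_smooth lam) H).
- intros x. unfold Lop.
  replace (Derive_n f 2 x) with (- (shifted V lam x * f x)).
  + unfold shifted. ring.
  + simpl. rewrite (Derive_ext _ df).
    * symmetry. apply is_derive_unique, H.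
    * intros t. apply is_derive_unique, H.
Qed.

Section Fixed_energy.
Variable lam : R.
Let q := shifted V lam.
Let E := eigenspace a V lam.
Let c := cosine_like q.
Let s := sine_like q.
Let dc := dwave q (PI / 2).
Let ds := dwave q 0.

Lemma solutions_agree (y1 dy1 y2 dy2 : R -> R) (x0 : R) :
  schrodinger q y1 dy1 -> schrodinger q y2 dy2 ->
  y1 x0 = y2 x0 -> dy1 x0 = dy2 x0 -> forall x, y1 x = y2 x /\ dy1 x = dy2 x.
Proof. apply (schrodinger_unique q _ _ _ _ (B + Rabs lam)), shifted_bound. Qed.

Lemma cosine_schrodinger : schrodinger q c dc.
Proof. apply (wave_schrodinger q _ _ (shifted_bounded_continuous lam)). Qed.

Lemma sine_schrodinger : schrodinger q s ds.
Proof. apply (wave_schrodinger q _ _ (shifted_bounded_continuous lam)). Qed.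

Lemma cosine_0 : c 0 = 1.
Proof. unfold c, cosine_like. rewrite wave_0. apply sin_PI2. Qed.
Lemma dcosine_0 : dc 0 = 0.
Proof. unfold dc. rewrite dwave_0. apply cos_PI2. Qed.
Lemma sine_0 : s 0 = 0.
Proof. unfold s, sine_like. rewrite wave_0. apply sin_0. Qed.
Lemma dsine_0 : ds 0 = 1.
Proof. unfold ds. rewrite dwave_0. apply cos_0. Qed.

Lemma eigenspace_decomposition (f : R -> R) :
  E f -> forall x, f x = f 0 * c x + Derive f 0 * s x.
Proof.
intros Hf x.
apply (solutions_agree _ _ _ _ 0 (eigenspace_schrodinger lam f Hf)
  (schrodinger_combination q _ _ _ _ (f 0) (Derive f 0)
     cosine_schrodinger sine_schrodinger)).
- rewrite cosine_0, sine_0. ring.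
- rewrite dcosine_0, dsine_0. ring.
Qed.

Lemma cosine_even (x : R) : c (0 - x) = c x.
Proof.
apply (solutions_agree _ _ _ _ 0 (schrodinger_reflect_0 lam _ _ cosine_schrodinger)
  cosine_schrodinger); rewrite Rminus_0_r; [easy |]. rewrite dcosine_0. ring.
Qed.

Lemma sine_odd (x : R) : s (0 - x) = - s x.
Proof.
assert (H : s (0 - x) = -1 * s x + 0 * s x); [| lra].
apply (solutions_agree _ _ _ _ 0 (schrodinger_reflect_0 lam _ _ sine_schrodinger)
  (schrodinger_combination q _ _ _ _ (-1) 0 sine_schrodinger sine_schrodinger));
  rewrite Rminus_0_r; [rewrite sine_0 | ]; ring.
Qed.

(** f(x) + f(-x) = 2 f(0) c(x) inherits the period of [f]. *)
Lemma cosine_in_eigenspace (f : R -> R) : E f -> f 0 <> 0 -> E c.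
Proof.
intros Hf H0. apply (schrodinger_eigenspace lam c dc cosine_schrodinger).
intros x.
assert (D := eigenspace_decomposition f Hf). assert (P := proj2 (proj1 Hf)).
assert (E1 := P x). assert (E2 := P (0 - (x + a))).
replace (0 - (x + a) + a) with (0 - x) in E2 by ring.
rewrite (D x), (D (x + a)) in E1.
rewrite (D (0 - (x + a))), (D (0 - x)), !cosine_even, !sine_odd in E2.
apply (Rmult_eq_reg_l (f 0)); [lra | easy].
Qed.

(** f(x) - f(-x) = 2 f'(0) s(x) inherits the period of [f]. *)
Lemma sine_in_eigenspace (f : R -> R) : E f -> Derive f 0 <> 0 -> E s.
Proof.
intros Hf H0. apply (schrodinger_eigenspace lam s ds sine_schrodinger).
intros x.
assert (D := eigenspace_decomposition f Hf). assert (P := proj2 (proj1 Hf)).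
assert (E1 := P x). assert (E2 := P (0 - (x + a))).
replace (0 - (x + a) + a) with (0 - x) in E2 by ring.
rewrite (D x), (D (x + a)) in E1.
rewrite (D (0 - (x + a))), (D (0 - x)), !cosine_even, !sine_odd in E2.
apply (Rmult_eq_reg_l (Derive f 0)); [lra | easy].
Qed.

(** An even function has period [a] iff it is symmetric about a/2; for a solution
this means that its derivative vanishes there. *)
Lemma eigenspace_cosine_iff : E c <-> cos (angle q (PI / 2) (a / 2)) = 0.
Proof.
assert (Ia : a - a / 2 = a / 2) by field.
assert (Hr := schrodinger_reflect_a lam _ _ cosine_schrodinger). split.
- intros [[_ Hp] _].
  assert (D : dc (a / 2) = - dc (a / 2)).
  { rewrite <- Ia at 2.
    rewrite <- (is_derive_unique _ _ _ (proj1 (Hr (a / 2)))).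
    rewrite <- (is_derive_unique _ _ _ (proj1 (cosine_schrodinger (a / 2)))).
    apply Derive_ext. intros t. rewrite <- (cosine_even (a - t)).
    rewrite (Hp (0 - (a - t))). f_equal. ring. }
  assert (D0 : dc (a / 2) = 0) by lra. unfold dc, dwave in D0.
  apply Rmult_integral in D0. destruct D0 as [D0 | D0]; [| easy].
  assert (A := amplitude_pos q (PI / 2) (a / 2)). lra.
- intros H0. apply (schrodinger_eigenspace lam c dc cosine_schrodinger).
  intros x.
  assert (D0 : dc (a / 2) = 0) by (unfold dc, dwave; rewrite H0; ring).
  destruct (solutions_agree _ _ _ _ (a / 2) Hr cosine_schrodinger) with (x := x + a)
    as [F _].
  + now rewrite Ia.
  + rewrite Ia, D0. ring.
  + rewrite <- F, <- cosine_even. f_equal. ring.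
Qed.

(** An odd function has period [a] iff it is antisymmetric about a/2; for a
solution this means that it vanishes there. *)
Lemma eigenspace_sine_iff : E s <-> sin (angle q 0 (a / 2)) = 0.
Proof.
assert (Ia : a - a / 2 = a / 2) by field.
assert (Hr := schrodinger_reflect_a lam _ _ sine_schrodinger). split.
- intros [[_ Hp] _].
  assert (D : s (a / 2) = - s (a / 2)).
  { rewrite <- sine_odd, (Hp (0 - a / 2)). f_equal. field. }
  assert (D0 : s (a / 2) = 0) by lra. unfold s, sine_like, wave in D0.
  apply Rmult_integral in D0. destruct D0 as [D0 | D0]; [| easy].
  assert (A := amplitude_pos q 0 (a / 2)). lra.
- intros H0. apply (schrodinger_eigenspace lam s ds sine_schrodinger).
  intros x.
  assert (D0 : s (a / 2) = 0) by (unfold s, sine_like, wave; rewrite H0; ring).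
  destruct (solutions_agree _ _ _ _ (a / 2) Hr
    (schrodinger_combination q _ _ _ _ (-1) 0 sine_schrodinger sine_schrodinger))
    with (x := x + a) as [F _].
  + rewrite Ia, D0. ring.
  + rewrite Ia. ring.
  + replace (a - (x + a)) with (0 - x) in F by ring. rewrite sine_odd in F. lra.
Qed.

Lemma angle_solves (w : R) : prufer q (angle q w).
Proof. apply (angle_prufer q (B + Rabs lam)), shifted_bounded_continuous. Qed.

Lemma angle_lt (w1 w2 x : R) : w1 < w2 -> 0 <= x -> angle q w1 x < angle q w2 x.
Proof.
intros H. apply (prufer_lt q _ _ (B + Rabs lam) 0).
- apply shifted_bound.
- apply angle_solves.
- apply angle_solves.
- now rewrite !angle_0.
Qed.

Lemma angle_interlace (x : R) : 0 <= x ->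
  angle q 0 x < angle q (PI / 2) x < angle q 0 x + PI.
Proof.
intros Hx. assert (HPI := PI_RGT_0). split; [apply angle_lt; lra |].
replace PI with (1 * PI) at 2 by ring.
apply (prufer_lt q _ (fun x => angle q 0 x + 1 * PI) (B + Rabs lam) 0 x).
- apply shifted_bound.
- apply angle_solves.
- apply prufer_shift, angle_solves.
- rewrite !angle_0. lra.
- easy.
Qed.

Lemma angle_0_pos (x : R) : 0 < x -> 0 < angle q 0 x.
Proof.
intros Hx. assert (H := prufer_crosses q (angle q 0) (B + Rabs lam) 0 x 0
  (shifted_bound lam) (angle_solves 0)).
rewrite Rmult_0_l, angle_0 in H. apply H; lra.
Qed.

Lemma cosine_level :
  E c -> exists k : nat, angle q (PI / 2) (a / 2) = PI / 2 + INR k * PI.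
Proof.
intros H. apply eigenspace_cosine_iff, cos_eq_0_0 in H. destruct H as [k Hk].
assert (HPI := PI_RGT_0). assert (P := angle_0_pos (a / 2) ltac:(lra)).
destruct (angle_interlace (a / 2) ltac:(lra)) as [P1 _].
assert (0 <= k)%Z.
{ apply Z.lt_succ_r, lt_IZR. rewrite succ_IZR.
  apply (Rmult_lt_reg_r PI); lra. }
exists (Z.to_nat k). rewrite INR_IZR_INZ, Z2Nat.id by easy. lra.
Qed.

Lemma sine_level :
  E s -> exists k : nat, (1 <= k)%nat /\ angle q 0 (a / 2) = INR k * PI.
Proof.
intros H. apply eigenspace_sine_iff, sin_eq_0_0 in H. destruct H as [k Hk].
assert (HPI := PI_RGT_0). assert (P := angle_0_pos (a / 2) ltac:(lra)).
assert (0 < k)%Z.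
{ apply lt_IZR. apply (Rmult_lt_reg_r PI); lra. }
exists (Z.to_nat k). rewrite INR_IZR_INZ, Z2Nat.id by lia. split; [lia | easy].
Qed.

(** An angle that is a multiple of pi/2 at a/2 is invariant under the reflection
in a/2, which exchanges its values at 0 and at [a]. *)
Lemma angle_full_period (w : R) (k : Z) :
  2 * angle q w (a / 2) = IZR k * PI ->
  angle q w a = IZR k * PI - w.
Proof.
intros Hk.
assert (H : prufer q (fun x => IZR k * PI - angle q w (a - x))).
{ intros t. assert (R := prufer_reflect q (angle q w) a (IZR k * PI)
    (angle_solves w) (sin_IZR_PI k) t).
  assert (Eq : q (a - t) = q t) by apply shifted_reflect.
  unfold prufer_field in *. rewrite <- Eq. exact R. }
assert (L : forall x, a / 2 <= x -> angle q w x = IZR k * PI - angle q w (a - x)).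
{ intros x Hx.
  assert (Ia : a - a / 2 = a / 2) by field.
  apply Rle_antisym.
  - apply (prufer_le q (angle q w) _ (B + Rabs lam) (a / 2) x (shifted_bound lam)
      (angle_solves w) H); [rewrite Ia; lra | easy].
  - apply (prufer_le q _ (angle q w) (B + Rabs lam) (a / 2) x (shifted_bound lam)
      H (angle_solves w)); [rewrite Ia; lra | easy]. }
rewrite L by lra. rewrite Rminus_diag, angle_0. easy.
Qed.

(** * Nodes of a periodic eigenfunction *)

(** The eigenvalue [lam] is the k-th Neumann or the k-th Dirichlet eigenvalue of
[0, a/2], Neumann ones being counted from 0 and Dirichlet ones from 1. *)
Definition level (k : nat) : Prop :=
  angle q (PI / 2) (a / 2) = PI / 2 + INR k * PI \/
  (1 <= k)%nat /\ angle q 0 (a / 2) = INR k * PI.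

Lemma level_full_turns (k : nat) : level k ->
  exists w0, angle q w0 a = w0 + 2 * INR k * PI.
Proof.
rewrite INR_IZR_INZ. intros [H | [_ H]]; rewrite INR_IZR_INZ in H.
- exists (PI / 2). rewrite (angle_full_period _ (1 + 2 * Z.of_nat k)).
  + rewrite plus_IZR, mult_IZR. field.
  + rewrite H, plus_IZR, mult_IZR. field.
- exists 0. rewrite (angle_full_period _ (2 * Z.of_nat k)).
  + rewrite mult_IZR. field.
  + rewrite H, mult_IZR. field.
Qed.

(** A translate of [th2] by a multiple of pi starts at most pi above [th1] and
stays above it. *)
Lemma winding_le (th1 th2 : R -> R) (m n : Z) :
  prufer q th1 -> prufer q th2 ->
  th1 a = th1 0 + IZR m * PI -> th2 a = th2 0 + IZR n * PI -> (m <= n)%Z.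
Proof.
intros H1 H2 E1 E2. assert (HPI := PI_RGT_0).
(* th2 + j pi starts in (th1 0, th1 0 + pi] *)
set (j := up ((th1 0 - th2 0) / PI)).
destruct (archimed ((th1 0 - th2 0) / PI)) as [A1 A2]. fold j in A1, A2.
set (d := (th1 0 - th2 0) / PI) in *.
assert (Ed : th1 0 - th2 0 = d * PI) by (unfold d; field; lra).
assert (L := prufer_le q th1 _ (B + Rabs lam) 0 a (shifted_bound lam) H1
  (prufer_shift q th2 j H2)). cbv beta in L.
assert (L' : th1 a <= th2 a + IZR j * PI).
{ apply L; [| lra]. assert (0 <= (IZR j - d) * PI) by (apply Rmult_le_pos; lra). lra. }
apply Z.lt_succ_r, lt_IZR. rewrite succ_IZR.
destruct (Req_dec (IZR j - d) 1) as [Hjd | Hjd].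
(* the start is exactly pi above: then the translate by j - 1 starts at th1 0 *)
- assert (L2 := prufer_le q th1 _ (B + Rabs lam) 0 a (shifted_bound lam) H1
    (prufer_shift q th2 (j - 1) H2)). cbv beta in L2.
  rewrite minus_IZR in L2.
  assert (L2' : th1 a <= th2 a + (IZR j - 1) * PI) by (apply L2; [| lra]; nra).
  apply (Rmult_lt_reg_r PI); nra.
- assert (IZR j - d < 1) by lra. apply (Rmult_lt_reg_r PI); nra.
Qed.

(** The zeros are the points where the angle takes one of the values
pi, 2 pi, ..., m pi, each of which it takes once on [0, a). Starting in (0, pi]
makes the list of values independent of the starting point. *)
Lemma prufer_zeros (th : R -> R) (m : nat) :
  prufer q th -> 0 < th 0 <= PI -> th a = th 0 + INR m * PI ->
  exists l : list R, NoDup l /\ length l = m /\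
    forall x, In x l <-> (0 <= x < a /\ sin (th x) = 0).
Proof.
intros H H0 Ha. assert (HPI := PI_RGT_0).
assert (X := fun x0 x k => prufer_crosses q th (B + Rabs lam) x0 x k (shifted_bound lam) H).
assert (Hcont : continuity th).
{ intros x. apply continuity_pt_filterlim. apply (is_derive_continuous _ _ _ (H x)). }
assert (P : forall i : nat, (i <= m)%nat -> exists l : list R, NoDup l /\ length l = i /\
  forall x, In x l <->
    (0 <= x < a /\ exists k : nat, (1 <= k <= i)%nat /\ th x = INR k * PI)).
{ induction i as [|i IH]; intros Hi.
  - exists nil. split; [constructor |]. split; [easy |]. intros x. split; [easy |].
    intros [_ [k [Hk _]]]. lia.
  - destruct (IH ltac:(lia)) as [l [Hl1 [Hl2 Hl3]]].
    assert (Him : INR i + 1 <= INR m) by (rewrite <- S_INR; apply le_INR; lia).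
    assert (Hi0 := pos_INR i).
    destruct (IVT_gen th 0 a (INR (S i) * PI) Hcont) as [x [Hx Ex]].
    { rewrite S_INR. rewrite Rmin_left, Rmax_right by nra. nra. }
    rewrite Rmin_left, Rmax_right in Hx by lra.
    assert (Hxa : x <> a).
    { intros ->. rewrite S_INR in Ex. nra. }
    exists (x :: l). split; [| split].
    + constructor; [| easy]. intros Hin. apply Hl3 in Hin.
      destruct Hin as [_ [k [Hk Ek]]]. rewrite Ex in Ek.
      apply Rmult_eq_reg_r in Ek; [| lra]. apply INR_eq in Ek. lia.
    + simpl. now rewrite Hl2.
    + intros z. simpl. rewrite Hl3. split.
      * intros [<- | [Hz [k [Hk Ek]]]].
        -- split; [lra |]. exists (S i). split; [lia | easy].
        -- split; [easy |]. exists k. split; [lia | easy].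
      * intros [Hz [k [Hk Ek]]]. destruct (Nat.eq_dec k (S i)) as [-> | Hne].
        -- left. rewrite INR_IZR_INZ in Ex, Ek.
           destruct (Rtotal_order x z) as [Hlt | [He | Hgt]]; [exfalso | easy | exfalso].
           ++ assert (T := X x z _ ltac:(rewrite Ex; apply Rle_refl) Hlt). lra.
           ++ assert (T := X z x _ ltac:(rewrite Ek; apply Rle_refl) Hgt). lra.
        -- right. split; [easy |]. exists k. split; [lia | easy]. }
destruct (P m (Nat.le_refl m)) as [l [Hl1 [Hl2 Hl3]]].
exists l. split; [easy |]. split; [easy |]. intros x. rewrite Hl3. split.
- intros [Hx [k [_ Ek]]]. split; [easy |]. rewrite Ek, INR_IZR_INZ. apply sin_IZR_PI.
- intros [Hx Es]. split; [easy |].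
  apply sin_eq_0_0 in Es. destruct Es as [k Ek].
  assert (Hpos : 0 < th x).
  { destruct (Req_dec x 0) as [-> | Hn]; [lra |].
    assert (T := X 0 x 0%Z). rewrite Rmult_0_l in T. apply T; lra. }
  assert (Hlt : th x < (INR m + 1) * PI).
  { destruct (Rlt_or_le (th x) ((INR m + 1) * PI)) as [| Hle]; [easy | exfalso].
    assert (Em : (INR m + 1) = IZR (Z.of_nat m + 1)) by now rewrite plus_IZR, INR_IZR_INZ.
    rewrite Em in Hle. assert (T := X x a _ Hle ltac:(lra)). rewrite <- Em in T. lra. }
  rewrite Ek in Hpos, Hlt.
  assert (K1 : (0 < k)%Z) by (apply lt_IZR, (Rmult_lt_reg_r PI); lra).
  assert (K2 : (k < Z.of_nat m + 1)%Z).
  { apply lt_IZR. rewrite plus_IZR, <- INR_IZR_INZ. apply (Rmult_lt_reg_r PI); lra. }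
  exists (Z.to_nat k). split; [lia |]. now rewrite INR_IZR_INZ, Z2Nat.id by lia.
Qed.

Lemma polar_form (u v : R) : u <> 0 \/ v <> 0 ->
  exists w rho, 0 < w <= PI /\ rho <> 0 /\ u = rho * sin w /\ v = rho * cos w.
Proof.
intros Huv. assert (HPI := PI_RGT_0).
destruct (Req_dec u 0) as [-> | Hu].
- exists PI, (- v). rewrite sin_PI, cos_PI. repeat split; try lra.
- set (z := v / u). exists (PI / 2 - atan z), (u * sqrt (1 + z ^ 2)).
  assert (Hs : 0 < sqrt (1 + z ^ 2)) by (apply sqrt_lt_R0; nra).
  destruct (atan_bound z) as [A1 A2].
  rewrite sin_shift, cos_shift, cos_atan, sin_atan.
  replace (1 + z²) with (1 + z ^ 2) by (unfold Rsqr; ring).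
  repeat split; try lra.
  + apply Rmult_integral_contrapositive. lra.
  + field. lra.
  + unfold z at 2. field. lra.
Qed.

(** The angle of [f], started in (0, pi], makes a whole number m of half-turns
over a period because (f, f') returns to its initial value; m equals the number
2k of half-turns of the Neumann or Dirichlet angle. *)
Theorem level_nodes (k : nat) (f : R -> R) :
  level k -> eigenfunction a V lam f -> has_nodes a f (2 * k).
Proof.
intros Hk [Hf [x0 Hx0]]. assert (HPI := PI_RGT_0).
assert (Hp := proj2 (proj1 Hf)).
assert (Hsch := eigenspace_schrodinger lam f Hf).
assert (Huv : f 0 <> 0 \/ Derive f 0 <> 0).
{ destruct (Req_dec (f 0) 0) as [E1 |]; [| now left].
  right. intros E2. apply Hx0.
  rewrite (eigenspace_decomposition f Hf), E1, E2. ring. }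
destruct (polar_form _ _ Huv) as [w [rho [Hw [Hrho [E1 E2]]]]].
assert (Hw' := wave_schrodinger q _ w (shifted_bounded_continuous lam)).
assert (G : forall x, f x = rho * wave q w x /\ Derive f x = rho * dwave q w x).
{ intros x. destruct (solutions_agree _ _ _ _ 0 Hsch
    (schrodinger_combination q _ _ _ _ rho 0 Hw' Hw')) with (x := x) as [G1 G2].
  - rewrite wave_0, E1. ring.
  - rewrite dwave_0, E2. ring.
  - split; lra. }
assert (Hr := amplitude_pos q w).
set (th := angle q w). assert (Hth : prufer q th) by apply angle_solves.
assert (Hth0 : th 0 = w) by apply angle_0.
assert (Ds : Derive f a = Derive f 0).
{ rewrite (Derive_ext f (fun x => f (x + a)) 0 Hp).
  destruct (Hsch a) as [Da _].
  symmetry. apply is_derive_unique. auto_derive.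
  - rewrite Rplus_0_l. eexists. apply Da.
  - rewrite Rplus_0_l. apply Rmult_1_l. }
assert (Fa : f a = f 0) by (rewrite (Hp 0); f_equal; ring).
assert (T : sin (th a - w) = 0).
{ rewrite sin_minus.
  assert (S1 : amplitude q w a * sin (th a) = sin w).
  { apply (Rmult_eq_reg_l rho); [| easy]. rewrite <- E1, <- Fa. symmetry. apply (G a). }
  assert (S2 : amplitude q w a * cos (th a) = cos w).
  { apply (Rmult_eq_reg_l rho); [| easy]. rewrite <- E2, <- Ds. symmetry. apply (G a). }
  rewrite <- S1, <- S2. ring. }
apply sin_eq_0_0 in T. destruct T as [m Em].
destruct (level_full_turns k Hk) as [w0 Hw0].
assert (Emk : m = Z.of_nat (2 * k)).
{ assert (W0 : angle q w0 a = angle q w0 0 + IZR (Z.of_nat (2 * k)) * PI).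
  { rewrite angle_0, Hw0, <- INR_IZR_INZ, mult_INR. simpl. ring. }
  assert (W1 : th a = th 0 + IZR m * PI) by lra.
  apply Z.le_antisymm.
  - apply (winding_le th (angle q w0)); auto using angle_solves.
  - apply (winding_le (angle q w0) th); auto using angle_solves. }
destruct (prufer_zeros th (2 * k) Hth ltac:(lra)) as [l [Hl1 [Hl2 Hl3]]].
{ rewrite INR_IZR_INZ, <- Emk. lra. }
exists l. split; [easy |]. split; [easy |]. intros x. rewrite Hl3.
split; intros [Hx Hs]; (split; [easy |]).
- rewrite (proj1 (G x)). unfold wave. fold th. rewrite Hs. ring.
- rewrite (proj1 (G x)) in Hs. unfold wave in Hs. fold th in Hs.
  apply Rmult_integral in Hs. destruct Hs as [Hs | Hs]; [easy |].
  apply Rmult_integral in Hs. destruct Hs as [Hs | Hs]; [| easy].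
  assert (A := Hr x). lra.
Qed.

End Fixed_energy.

(** * Dependence on the eigenvalue parameter *)

Let angle_at (w lam : R) : R := angle (shifted V lam) w (a / 2).

Lemma angle_at_step (w lam delta : R) : 0 <= delta ->
  angle_at w lam <= angle_at w (lam + delta)
    <= angle_at w lam + delta * (a / 2) * exp ((B + Rabs lam + 1) * (a / 2)).
Proof.
intros Hd.
assert (H2 : prufer (fun t => shifted V lam t + delta) (angle (shifted V (lam + delta)) w)).
{ intros t. replace (shifted V lam t + delta) with (shifted V (lam + delta) t)
    by (unfold shifted; ring).
  assert (H := angle_solves (lam + delta) w t). unfold prufer_field in *.
  replace (shifted V lam t + delta) with (shifted V (lam + delta) t)
    by (unfold shifted; ring). exact H. }
assert (H0 : angle (shifted V lam) w 0 = angle (shifted V (lam + delta)) w 0)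
  by now rewrite !angle_0.
split.
- apply (prufer_mono (shifted V lam) (B + Rabs lam) delta 0 _ _
    (shifted_bound lam) (angle_solves lam w) H2 H0); lra.
- assert (D := prufer_dependence (shifted V lam) (B + Rabs lam) delta 0 _ _
    (shifted_bound lam) (angle_solves lam w) H2 H0 (a / 2) Hd ltac:(lra)).
  rewrite Rminus_0_r in D. unfold angle_at. lra.
Qed.

Lemma angle_at_increasing (w lam mu : R) : lam < mu -> angle_at w lam < angle_at w mu.
Proof.
intros Hlt. replace mu with (lam + (mu - lam)) by ring.
assert (H2 : prufer (fun t => shifted V lam t + (mu - lam)) (angle (shifted V mu) w)).
{ intros t. assert (H := angle_solves mu w t). unfold prufer_field in *.
  replace (shifted V lam t + (mu - lam)) with (shifted V mu t)
    by (unfold shifted; ring). exact H. }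
replace (lam + (mu - lam)) with mu by ring.
apply (prufer_strict_mono (shifted V lam) (B + Rabs lam) (mu - lam) 0 _ _
    (shifted_bound lam) (angle_solves lam w) H2); [| lra | lra].
now rewrite !angle_0.
Qed.

Lemma angle_at_le (w lam mu : R) : lam <= mu -> angle_at w lam <= angle_at w mu.
Proof.
intros [H | ->]; [left; now apply angle_at_increasing | apply Rle_refl].
Qed.

Lemma angle_at_inj (w lam mu : R) : angle_at w lam = angle_at w mu -> lam = mu.
Proof.
intros E. destruct (Rtotal_order lam mu) as [H | [H | H]]; [| easy |];
  apply (angle_at_increasing w) in H; lra.
Qed.

(** [angle_at_step] bounds the increment by a constant times the step, where the
constant is uniform as long as the parameter stays within 1 of [lam]. *)
Lemma angle_at_continuous (w : R) : continuity (angle_at w).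
Proof.
intros lam. apply continuity_pt_filterlim, filterlim_locally. intros eps.
set (C := a / 2 * exp ((B + (Rabs lam + 1) + 1) * (a / 2))).
assert (HC : 0 < C) by (apply Rmult_lt_0_compat; [lra | apply exp_pos]).
assert (Hd : 0 < Rmin 1 (eps / C)).
{ apply Rmin_pos; [lra |]. apply Rdiv_lt_0_compat; [apply cond_pos | easy]. }
assert (S : forall l delta, 0 <= delta -> Rabs l <= Rabs lam + 1 ->
  Rabs (angle_at w (l + delta) - angle_at w l) <= delta * C).
{ intros l delta H1 H2. destruct (angle_at_step w l delta H1) as [A1 A2].
  rewrite Rabs_right by lra.
  apply Rle_trans with (delta * (a / 2) * exp ((B + Rabs l + 1) * (a / 2))); [lra |].
  unfold C. rewrite Rmult_assoc. apply Rmult_le_compat_l; [easy |].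
  apply Rmult_le_compat_l; [lra |]. apply exp_le_compat.
  apply Rmult_le_compat_r; lra. }
exists (mkposreal _ Hd). intros mu Hmu.
assert (Hmu' : Rabs (mu - lam) < Rmin 1 (eps / C)) by exact Hmu.
assert (M1 := Rmin_l 1 (eps / C)). assert (M2 := Rmin_r 1 (eps / C)).
assert (Hl : Rabs mu <= Rabs lam + 1).
{ replace mu with (lam + (mu - lam)) by ring.
  apply Rle_trans with (1 := Rabs_triang _ _). lra. }
assert (Hlt : Rabs (mu - lam) * C < eps).
{ apply Rlt_le_trans with (eps / C * C); [apply Rmult_lt_compat_r; lra |].
  right. field. lra. }
change (Rabs (angle_at w mu - angle_at w lam) < eps).
apply Rle_lt_trans with (2 := Hlt).
destruct (Rle_or_lt lam mu) as [H | H].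
- rewrite (Rabs_right (mu - lam)) by lra.
  replace mu with (lam + (mu - lam)) at 1 by ring. apply S; lra.
- rewrite (Rabs_left (mu - lam)), Rabs_minus_sym by lra.
  replace lam with (mu + - (mu - lam)) at 1 by ring. apply S; lra.
Qed.

Lemma angle_at_IVT (w l1 l2 y : R) :
  angle_at w l1 <= y <= angle_at w l2 -> exists lam, angle_at w lam = y.
Proof.
intros Hy. destruct (IVT_gen (angle_at w) l1 l2 y (angle_at_continuous w)) as [l [_ E]].
- rewrite Rmin_left, Rmax_right by lra. exact Hy.
- now exists l.
Qed.

(** The constant pi/2 is a supersolution if q <= 0 and a subsolution if q >= 0,
and for lam = -B and lam = B these signs are known. *)
Lemma ground_level_exists : exists lam, angle_at (PI / 2) lam = PI / 2 + INR 0 * PI.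
Proof.
assert (S2 : forall q t, prufer_field q t (PI / 2) = q t).
{ intros q t. unfold prufer_field. rewrite sin_PI2. ring. }
apply (angle_at_IVT (PI / 2) (- B) B).
replace (PI / 2 + INR 0 * PI) with (PI / 2) by (simpl; ring).
unfold angle_at. split.
- apply (sub_super_le (shifted V (- B)) _ 0 (angle (shifted V (- B)) (PI / 2))
    (fun t => prufer_field (shifted V (- B)) t (angle (shifted V (- B)) (PI / 2) t))
    (fun _ => PI / 2) (fun _ => 0) (shifted_bound (- B)) (angle_solves (- B) (PI / 2))).
  + intros t. apply @is_derive_const.
  + intros t. apply Rle_refl.
  + intros t. cbv beta. rewrite S2. unfold shifted.
    assert (H := V_bound t). apply Rabs_le_between in H. lra.
  + rewrite angle_0. apply Rle_refl.
  + lra.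
- apply (sub_super_le (shifted V B) _ 0 (fun _ => PI / 2) (fun _ => 0)
    (angle (shifted V B) (PI / 2))
    (fun t => prufer_field (shifted V B) t (angle (shifted V B) (PI / 2) t))
    (shifted_bound B)).
  + intros t. apply @is_derive_const.
  + apply (angle_solves B (PI / 2)).
  + intros t. cbv beta. rewrite S2. unfold shifted.
    assert (H := V_bound t). apply Rabs_le_between in H. lra.
  + intros t. apply Rle_refl.
  + rewrite angle_0. apply Rle_refl.
  + lra.
Qed.

Lemma angle_at_interlace (lam : R) :
  angle_at 0 lam < angle_at (PI / 2) lam < angle_at 0 lam + PI.
Proof. apply angle_interlace. lra. Qed.

(** The angles at a/2 are multiples of pi or of pi shifted by pi/2, and the
Neumann and Dirichlet angles differ by less than pi. *)
Lemma level_mono (lam mu : R) (k l : nat) :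
  lam <= mu -> level lam k -> level mu l -> (k <= l)%nat.
Proof.
intros Hle Hk Hl. assert (HPI := PI_RGT_0).
assert (I1 := angle_at_interlace lam). assert (I2 := angle_at_interlace mu).
assert (M1 := angle_at_le 0 lam mu Hle). assert (M2 := angle_at_le (PI / 2) lam mu Hle).
apply Nat.lt_succ_r, INR_lt. rewrite S_INR. apply (Rmult_lt_reg_r PI); [easy |].
unfold level in Hk, Hl. fold (angle_at 0 lam) (angle_at (PI / 2) lam) in Hk.
fold (angle_at 0 mu) (angle_at (PI / 2) mu) in Hl.
destruct Hk as [Hk | [_ Hk]], Hl as [Hl | [_ Hl]]; lra.
Qed.

Lemma level_unique (lam : R) (k l : nat) : level lam k -> level lam l -> k = l.
Proof.
intros Hk Hl. apply Nat.le_antisymm; apply (level_mono lam lam);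
  auto using Rle_refl.
Qed.

(** At level [k] the Dirichlet angle exceeds (k - 1) pi, whence the intermediate
value theorem reaches both problems at every level below [k], though perhaps
not at [k] itself. *)
Lemma lower_levels_exist (lam : R) (k l : nat) : level lam k -> (l < k)%nat ->
  (exists mu, angle_at (PI / 2) mu = PI / 2 + INR l * PI) /\
  ((1 <= l)%nat -> exists mu, angle_at 0 mu = INR l * PI).
Proof.
intros Hk Hl. assert (HPI := PI_RGT_0). destruct ground_level_exists as [l0 E0].
assert (I0 := angle_at_interlace l0). assert (I := angle_at_interlace lam).
assert (Hlk : (INR l + 1) * PI <= INR k * PI).
{ apply Rmult_le_compat_r; [lra |]. rewrite <- S_INR. apply le_INR. lia. }
assert (Hl0 : 0 <= INR l * PI) by (apply Rmult_le_pos; [apply pos_INR | lra]).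
assert (T : INR k * PI - PI / 2 <= angle_at (PI / 2) lam - PI / 2
            /\ INR k * PI - PI <= angle_at 0 lam).
{ unfold level in Hk. fold (angle_at 0 lam) (angle_at (PI / 2) lam) in Hk.
  destruct Hk as [Hk | [_ Hk]]; lra. }
simpl in E0. split.
- apply (angle_at_IVT _ l0 lam). lra.
- intros Hl1. apply (angle_at_IVT _ l0 lam).
  assert (1 * PI <= INR l * PI); [| lra].
  apply Rmult_le_compat_r; [lra |]. now apply (le_INR 1).
Qed.

Lemma cosine_eigen_iff (lam : R) :
  eigenspace a V lam (cosine_like (shifted V lam)) <->
  exists k, angle_at (PI / 2) lam = PI / 2 + INR k * PI.
Proof.
split; [apply cosine_level |].
intros [k Hk]. apply eigenspace_cosine_iff. unfold angle_at in Hk. rewrite Hk.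
rewrite cos_plus, cos_PI2, INR_IZR_INZ, sin_IZR_PI. ring.
Qed.

Lemma sine_eigen_iff (lam : R) :
  eigenspace a V lam (sine_like (shifted V lam)) <->
  exists k, (1 <= k)%nat /\ angle_at 0 lam = INR k * PI.
Proof.
split; [apply sine_level |].
intros [k [_ Hk]]. apply eigenspace_sine_iff. unfold angle_at in Hk. rewrite Hk.
rewrite INR_IZR_INZ. apply sin_IZR_PI.
Qed.

Lemma eigenfunction_level (lam : R) (g : R -> R) :
  eigenfunction a V lam g -> exists k, level lam k.
Proof.
intros [Hg [x Hx]]. rewrite (eigenspace_decomposition lam g Hg) in Hx.
destruct (Req_dec (g 0) 0) as [E1 | E1].
- destruct (Req_dec (Derive g 0) 0) as [E2 | E2].
  + exfalso. apply Hx. rewrite E1, E2. ring.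
  + destruct (proj1 (sine_eigen_iff lam) (sine_in_eigenspace lam g Hg E2)) as [k Hk].
    exists k. now right.
- destruct (proj1 (cosine_eigen_iff lam) (cosine_in_eigenspace lam g Hg E1)) as [k Hk].
  exists k. now left.
Qed.

Lemma sine_nonzero (lam : R) : exists x, sine_like (shifted V lam) x <> 0.
Proof.
destruct (Classical_Prop.classic (exists x, sine_like (shifted V lam) x <> 0)) as [| N];
  [easy | exfalso].
assert (Z : forall x, sine_like (shifted V lam) x = 0).
{ intros x. destruct (Req_dec (sine_like (shifted V lam) x) 0) as [| H]; [easy |].
  exfalso. apply N. now exists x. }
assert (D := is_derive_unique _ _ _ (proj1 (sine_schrodinger lam 0))).
rewrite dsine_0, (Derive_ext _ (fun _ => 0) _ Z), Derive_const in D. lra.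
Qed.

(** * Eigenspaces *)

Lemma eigenspace_dim_le_2 (lam : R) (n : nat) :
  has_dim (eigenspace a V lam) n -> (n <= 2)%nat.
Proof.
apply has_dim_le_2 with (u := fun f => f 0) (v := fun f => Derive f 0)
  (g := cosine_like (shifted V lam)) (h := sine_like (shifted V lam)).
intros f Hf. now apply eigenspace_decomposition.
Qed.

Lemma eigenspace_dim_both (lam : R) (n : nat) :
  eigenspace a V lam (cosine_like (shifted V lam)) ->
  eigenspace a V lam (sine_like (shifted V lam)) ->
  has_dim (eigenspace a V lam) n -> (2 <= n)%nat.
Proof.
intros Hc Hs. destruct (sine_nonzero lam) as [x Hx].
apply (has_dim_ge_2 _ _ _ 0 x n Hc Hs); [| apply sine_0 | easy].
rewrite cosine_0. lra.
Qed.

Lemma eigenspace_no_sine (lam : R) (f : R -> R) :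
  ~ eigenspace a V lam (sine_like (shifted V lam)) -> eigenspace a V lam f ->
  forall x, f x = f 0 * cosine_like (shifted V lam) x.
Proof.
intros N Hf x. rewrite (eigenspace_decomposition lam f Hf) at 1.
destruct (Req_dec (Derive f 0) 0) as [-> | H]; [ring |].
exfalso. apply N. now apply (sine_in_eigenspace lam f).
Qed.

Lemma eigenspace_no_cosine (lam : R) (f : R -> R) :
  ~ eigenspace a V lam (cosine_like (shifted V lam)) -> eigenspace a V lam f ->
  forall x, f x = Derive f 0 * sine_like (shifted V lam) x.
Proof.
intros N Hf x. rewrite (eigenspace_decomposition lam f Hf) at 1.
destruct (Req_dec (f 0) 0) as [-> | H]; [ring |].
exfalso. apply N. now apply (cosine_in_eigenspace lam f).
Qed.

Lemma eigenspace_dim_2_both (lam : R) (n : nat) :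
  has_dim (eigenspace a V lam) n -> (2 <= n)%nat ->
  eigenspace a V lam (cosine_like (shifted V lam)) /\
  eigenspace a V lam (sine_like (shifted V lam)).
Proof.
intros Hn H2. split; apply Classical_Prop.NNPP; intros N.
- assert (H := has_dim_le_1 _ (fun f => Derive f 0) _ n
    (fun f Hf => eigenspace_no_cosine lam f N Hf) Hn). lia.
- assert (H := has_dim_le_1 _ (fun f => f 0) _ n
    (fun f Hf => eigenspace_no_sine lam f N Hf) Hn). lia.
Qed.

Lemma Derive_cosine_0 (lam : R) : Derive (cosine_like (shifted V lam)) 0 = 0.
Proof.
rewrite (is_derive_unique _ _ _ (proj1 (cosine_schrodinger lam 0))). apply dcosine_0.
Qed.

Lemma Derive_sine_0 (lam : R) : Derive (sine_like (shifted V lam)) 0 = 1.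
Proof.
rewrite (is_derive_unique _ _ _ (proj1 (sine_schrodinger lam 0))). apply dsine_0.
Qed.

Lemma eigenspace_two_basis (lam : R) :
  has_dim (eigenspace a V lam) 2 ->
  is_basis (eigenspace a V lam)
    [cosine_like (shifted V lam); sine_like (shifted V lam)].
Proof.
intros H2. destruct (eigenspace_dim_2_both lam 2 H2 (Nat.le_refl 2)) as [Hc Hs].
destruct (sine_nonzero lam) as [x0 Hx0]. split; [| split].
- simpl. now intros f [<- | [<- |]].
- intros [| k1 [| k2 [|]]]; simpl; intros L H; try discriminate.
  unfold lincomb in H. simpl in H.
  assert (H0 := H 0). rewrite cosine_0, sine_0 in H0.
  assert (K1 : k1 = 0) by lra. assert (Hx := H x0). rewrite K1 in Hx.
  assert (Hx' : k2 * sine_like (shifted V lam) x0 = 0) by lra.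
  apply Rmult_integral in Hx'. intros t [<- | [<- |]]; tauto.
- intros f Hf. exists [f 0; Derive f 0]. split; [easy |]. intros x.
  rewrite (eigenspace_decomposition lam f Hf). unfold lincomb. simpl. ring.
Qed.

Lemma eigenspace_singleton_basis (lam : R) (u : (R -> R) -> R) (g : R -> R) (x0 : R) :
  eigenspace a V lam g -> g x0 <> 0 ->
  (forall f, eigenspace a V lam f -> forall x, f x = u f * g x) ->
  eigenfunction a V lam g /\ is_basis (eigenspace a V lam) [g].
Proof.
intros Hg Hx0 Hu. split; [split; [easy | now exists x0] |]. split; [| split].
- simpl. now intros f [<- |].
- intros [| k [|]]; simpl; intros L H; try discriminate.
  unfold lincomb in H. simpl in H. assert (H0 := H x0).
  intros t [<- |]; [| easy]. apply (Rmult_eq_reg_r (g x0)); lra.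
- intros f Hf. exists [u f]. split; [easy |]. intros x. unfold lincomb. simpl.
  rewrite (Hu f Hf x). ring.
Qed.

Lemma eigenspace_one_basis (lam : R) :
  has_dim (eigenspace a V lam) 1 ->
  exists g, eigenfunction a V lam g /\ is_basis (eigenspace a V lam) [g] /\
    ((g 0 = 1 /\ Derive g 0 = 0) \/ (g 0 = 0 /\ Derive g 0 = 1)).
Proof.
intros H1.
set (c := cosine_like (shifted V lam)). set (s := sine_like (shifted V lam)).
destruct (Classical_Prop.classic (eigenspace a V lam c)) as [Hc | Nc].
- assert (Ns : ~ eigenspace a V lam s).
  { intros Hs. assert (H := eigenspace_dim_both lam 1 Hc Hs H1). lia. }
  exists c. assert (C0 : c 0 = 1) by apply cosine_0.
  destruct (eigenspace_singleton_basis lam (fun f => f 0) c 0 Hc) as [A1 A2].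
  + rewrite C0. lra.
  + intros f Hf. now apply eigenspace_no_sine.
  + split; [easy |]. split; [easy |]. left. split; [easy | apply Derive_cosine_0].
- assert (Hs : eigenspace a V lam s).
  { apply Classical_Prop.NNPP. intros Ns.
    assert (H := has_dim_le_1 _ (fun f => Derive f 0) s 1
      (fun f Hf => eigenspace_no_cosine lam f Nc Hf) H1).
    destruct H1 as [b [L [Hb [Hi _]]]]. destruct b as [| b1 [|]]; try discriminate.
    assert (Hb1 := Hb b1 (or_introl eq_refl)).
    assert (Z : 1 = 0); [| lra].
    apply (Hi [1] eq_refl); [| now left]. intros x. unfold lincomb. simpl.
    rewrite (eigenspace_no_sine lam b1 Ns Hb1 x).
    assert (Z := eigenspace_no_cosine lam b1 Nc Hb1 0). rewrite sine_0 in Z.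
    rewrite Z. ring. }
  exists s. destruct (sine_nonzero lam) as [x Hx].
  destruct (eigenspace_singleton_basis lam (fun f => Derive f 0) s x Hs Hx) as [A1 A2].
  + intros f Hf. now apply eigenspace_no_cosine.
  + split; [easy |]. split; [easy |]. right. split; [apply sine_0 | apply Derive_sine_0].
Qed.

(** * Enumeration of the spectrum *)

Section Enumeration.
Variable lam : nat -> R.
Hypothesis lam_spectrum : is_spectrum a V lam.

Lemma lam_le (i j : nat) : (1 <= i)%nat -> (i <= j)%nat -> lam i <= lam j.
Proof.
intros Hi Hij. induction Hij as [| j Hij IH]; [apply Rle_refl |].
apply Rle_trans with (1 := IH). apply lam_spectrum. lia.
Qed.

Lemma spectrum_list (mu : R) : exists l : list nat, NoDup l /\
  (forall j, In j l <-> (1 <= j)%nat /\ lam j = mu) /\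
  has_dim (eigenspace a V mu) (length l).
Proof. apply lam_spectrum. Qed.

Lemma spectrum_attained (mu : R) (k : nat) : level mu k ->
  exists j, (1 <= j)%nat /\ lam j = mu.
Proof.
intros Hk. destruct (spectrum_list mu) as [l [_ [Hl Hd]]].
assert (L : (1 <= length l)%nat).
{ destruct Hk as [Hk | [H1 Hk]].
  - apply (has_dim_ge_1 _ (cosine_like (shifted V mu)) 0 _) with (3 := Hd).
    + apply cosine_eigen_iff. now exists k.
    + rewrite cosine_0. lra.
  - destruct (sine_nonzero mu) as [x Hx].
    apply (has_dim_ge_1 _ (sine_like (shifted V mu)) x _) with (3 := Hd); [| easy].
    apply sine_eigen_iff. now exists k. }
destruct l as [| j l]; [simpl in L; lia |]. exists j. apply Hl. now left.
Qed.

Lemma spectrum_level (j : nat) : (1 <= j)%nat -> exists k, level (lam j) k.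
Proof.
intros Hj. destruct (spectrum_list (lam j)) as [l [_ [Hl Hd]]].
destruct Hd as [b [Hb1 [Hb2 [Hb3 _]]]].
assert (Hin : In j l) by now apply Hl.
destruct l as [| i l]; [easy |]. destruct b as [| g b]; [discriminate |].
apply (eigenfunction_level (lam j) g). split; [apply Hb2; now left |].
apply Classical_Prop.NNPP. intros N.
assert (Z : forall x, g x = 0).
{ intros x. destruct (Req_dec (g x) 0) as [| H]; [easy |]. exfalso. apply N. now exists x. }
assert (Z1 : 1 = 0); [| lra].
apply (Hb3 (1 :: repeat 0 (length b))).
- simpl. now rewrite repeat_length.
- intros x. unfold lincomb. simpl.
  change (1 * g x + lincomb (repeat 0 (length b)) b x = 0).
  rewrite lincomb_zeros, Z. ring.
- now left.
Qed.

(** A value listed twice has a two-dimensional eigenspace, so both [c] and [s] are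
periodic, and by uniqueness of the level both are so at level [k]. *)
Lemma repeated_value_both (i j k : nat) : (1 <= i)%nat -> (1 <= j)%nat -> i <> j ->
  lam i = lam j -> level (lam i) k ->
  angle_at (PI / 2) (lam i) = PI / 2 + INR k * PI /\ angle_at 0 (lam i) = INR k * PI.
Proof.
intros Hi Hj Hij E Hk. destruct (spectrum_list (lam i)) as [l [Hnd [Hl Hd]]].
assert (L : (2 <= length l)%nat).
{ apply (NoDup_incl_length (l := [i; j])).
  - constructor; [simpl; intros [|]; [congruence | easy] |].
    constructor; [easy | constructor].
  - intros x [<- | [<- |]]; [| | easy]; now apply Hl. }
destruct (eigenspace_dim_2_both _ _ Hd L) as [Hc Hs].
apply cosine_eigen_iff in Hc. apply sine_eigen_iff in Hs.
destruct Hc as [k1 H1], Hs as [k2 H2].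
rewrite (level_unique (lam i) k k1) at 1 by (easy || now left).
rewrite (level_unique (lam i) k k2) by (easy || now right).
easy.
Qed.

(** Among three indices of one level two are of the same kind, so they have the
same value, which is then the Neumann and the Dirichlet eigenvalue of the level;
the third index has the same value too, and its multiplicity would be 3. *)
Lemma level_at_most_two (i1 i2 i3 k : nat) :
  (1 <= i1)%nat -> (i1 < i2)%nat -> (i2 < i3)%nat ->
  level (lam i1) k -> level (lam i2) k -> level (lam i3) k -> False.
Proof.
intros H1 H12 H23 L1 L2 L3.
assert (F : lam i2 = lam i1 -> lam i3 = lam i1 -> False).
{ intros E2 E3. destruct (spectrum_list (lam i1)) as [l [Hnd [Hl Hd]]].
  assert (L : (3 <= length l)%nat).
  { apply (NoDup_incl_length (l := [i1; i2; i3])).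
    - repeat constructor; simpl; lia.
    - intros x [<- | [<- | [<- |]]]; [| | | easy]; apply Hl; (split; [lia | easy]). }
  assert (D := eigenspace_dim_le_2 _ _ Hd). lia. }
assert (G : forall i j m, (1 <= i)%nat -> (1 <= j)%nat -> i <> j -> lam i = lam j ->
  level (lam i) k -> level (lam m) k -> lam m = lam i).
{ intros i j m Hi Hj Hij E Li Lm.
  destruct (repeated_value_both i j k Hi Hj Hij E Li) as [A1 A2].
  destruct Lm as [Lm | [_ Lm]]; [apply (angle_at_inj (PI / 2)) | apply (angle_at_inj 0)];
    unfold angle_at in *; congruence. }
assert (I : lam i1 = lam i2 \/ lam i1 = lam i3 \/ lam i2 = lam i3).
{ destruct L1 as [L1 | [_ L1]], L2 as [L2 | [_ L2]], L3 as [L3 | [_ L3]];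
  first [ left; apply (angle_at_inj (PI / 2)); unfold angle_at; congruence
        | left; apply (angle_at_inj 0); unfold angle_at; congruence
        | right; left; apply (angle_at_inj (PI / 2)); unfold angle_at; congruence
        | right; left; apply (angle_at_inj 0); unfold angle_at; congruence
        | right; right; apply (angle_at_inj (PI / 2)); unfold angle_at; congruence
        | right; right; apply (angle_at_inj 0); unfold angle_at; congruence ]. }
destruct I as [I | [I | I]].
- apply F; [easy |]. apply (G i1 i2 i3); auto; lia.
- apply F; [| easy]. apply (G i1 i3 i2); auto; lia.
- assert (E : lam i1 = lam i2) by (apply (G i2 i3 i1); auto; lia).
  apply F; congruence.
Qed.

Lemma level_at_least_two (mu : R) (k m : nat) :
  level mu k -> (1 <= m)%nat -> (m < k)%nat ->
  exists i j, (1 <= i)%nat /\ (1 <= j)%nat /\ i <> j /\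
    level (lam i) m /\ level (lam j) m.
Proof.
intros Hk Hm Hmk. destruct (lower_levels_exist mu k m Hk Hmk) as [[mu1 E1] H2].
destruct (H2 Hm) as [mu2 E2].
assert (L1 : level mu1 m) by now left. assert (L2 : level mu2 m) by now right.
destruct (Req_dec mu1 mu2) as [<- | N].
- destruct (spectrum_list mu1) as [l [Hnd [Hl Hd]]].
  assert (L : (2 <= length l)%nat).
  { apply (eigenspace_dim_both mu1); [| | easy].
    - apply cosine_eigen_iff. now exists m.
    - apply sine_eigen_iff. now exists m. }
  destruct l as [| i [| j l]]; simpl in L; try lia.
  destruct (proj1 (Hl i) ltac:(simpl; tauto)) as [Hi Ei].
  destruct (proj1 (Hl j) ltac:(simpl; tauto)) as [Hj Ej].
  exists i, j. rewrite Ei, Ej. repeat split; auto.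
  intros ->. inversion Hnd. simpl in *. tauto.
- destruct (spectrum_attained mu1 m L1) as [i [Hi Ei]].
  destruct (spectrum_attained mu2 m L2) as [j [Hj Ej]].
  exists i, j. rewrite Ei, Ej. repeat split; auto. congruence.
Qed.

Lemma lam_level_mono (i j k l : nat) : (1 <= i)%nat -> (i <= j)%nat ->
  level (lam i) k -> level (lam j) l -> (k <= l)%nat.
Proof. intros Hi Hij. now apply level_mono, lam_le. Qed.

(** An odd index 2m + 3 cannot skip level m + 1, since both eigenvalues of that
level must be listed and only the index 2m + 2 is left for them; an even index
2m + 4 cannot repeat level m + 1, which is then exhausted, nor skip level
m + 2. At the start, lam 1 < lam 2 takes the place of counting, level 0
being Neumann only. *)
Lemma spectrum_levels (m : nat) :
  level (lam (2 * m + 1)) m /\ level (lam (2 * m + 2)) (m + 1).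
Proof.
induction m as [| m [IH1 IH2]].
- assert (L1 : level (lam 1) 0).
  { destruct ground_level_exists as [mu E].
    assert (Lmu : level mu 0) by now left.
    destruct (spectrum_attained mu 0 Lmu) as [j [Hj Ej]]. rewrite <- Ej in Lmu.
    destruct (spectrum_level 1 (Nat.le_refl 1)) as [k Hk].
    assert (H := lam_level_mono 1 j k 0 (Nat.le_refl 1) Hj Hk Lmu).
    now replace k with 0%nat in Hk by lia. }
  split; [easy |]. simpl.
  destruct (spectrum_level 2 ltac:(lia)) as [k Hk].
  destruct (Nat.eq_dec k 0) as [-> | N0].
  { exfalso. destruct L1 as [L1 | [? _]]; [| lia]. destruct Hk as [Hk | [? _]]; [| lia].
    assert (H := proj1 lam_spectrum).
    apply (angle_at_increasing (PI / 2)) in H. unfold angle_at in H. lra. }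
  destruct (Nat.eq_dec k 1) as [-> | N1]; [easy | exfalso].
  destruct (lower_levels_exist (lam 2) k 1 Hk ltac:(lia)) as [[mu E] _].
  assert (Lmu : level mu 1) by now left.
  destruct (spectrum_attained mu 1 Lmu) as [i [Hi Ei]]. rewrite <- Ei in Lmu.
  destruct (Nat.eq_dec i 1) as [-> | Ni].
  + assert (H := level_unique _ _ _ L1 Lmu). lia.
  + assert (H := lam_level_mono 2 i k 1 ltac:(lia) ltac:(lia) Hk Lmu). lia.
- replace (2 * S m + 1)%nat with (2 * m + 3)%nat by lia.
  replace (2 * S m + 2)%nat with (2 * m + 4)%nat by lia.
  rewrite Nat.add_1_r in IH2.
  assert (L3 : level (lam (2 * m + 3)) (S m)).
  { destruct (spectrum_level (2 * m + 3) ltac:(lia)) as [k Hk].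
    assert (H := lam_level_mono (2 * m + 2) (2 * m + 3) _ _ ltac:(lia) ltac:(lia) IH2 Hk).
    destruct (Nat.eq_dec k (S m)) as [-> | N]; [easy | exfalso].
    destruct (level_at_least_two _ k (S m) Hk ltac:(lia) ltac:(lia))
      as [i [j [Hi [Hj [Hij [Li Lj]]]]]].
    assert (P : forall i, (1 <= i)%nat -> level (lam i) (S m) -> i = (2 * m + 2)%nat).
    { clear i j Hi Hj Hij Li Lj. intros i Hi Li.
      destruct (Nat.lt_trichotomy i (2 * m + 2)) as [C | [C | C]]; [| easy |].
      - assert (T := lam_level_mono i (2 * m + 1) _ _ Hi ltac:(lia) Li IH1). lia.
      - assert (T := lam_level_mono (2 * m + 3) i _ _ ltac:(lia) ltac:(lia) Hk Li). lia. }
    apply Hij. rewrite (P i), (P j); auto. }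
  split; [easy |].
  destruct (spectrum_level (2 * m + 4) ltac:(lia)) as [k Hk].
  assert (H := lam_level_mono (2 * m + 3) (2 * m + 4) _ _ ltac:(lia) ltac:(lia) L3 Hk).
  destruct (Nat.eq_dec k (S m)) as [-> | N0].
  { exfalso. apply (level_at_most_two (2 * m + 2) (2 * m + 3) (2 * m + 4) (S m));
      auto; lia. }
  destruct (Nat.eq_dec k (S m + 1)) as [-> | N1]; [easy | exfalso].
  destruct (lower_levels_exist _ k (S m + 1) Hk ltac:(lia)) as [[mu E] _].
  assert (Lmu : level mu (S m + 1)) by now left.
  destruct (spectrum_attained mu _ Lmu) as [i [Hi Ei]]. rewrite <- Ei in Lmu.
  destruct (Nat.le_gt_cases i (2 * m + 3)) as [C | C].
  + assert (T := lam_level_mono i (2 * m + 3) _ _ Hi C Lmu L3). lia.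
  + assert (T := lam_level_mono (2 * m + 4) i _ _ ltac:(lia) ltac:(lia) Hk Lmu). lia.
Qed.

Lemma lam_level (j : nat) : (1 <= j)%nat -> level (lam j) (Nat.div2 j).
Proof.
intros Hj. assert (E := Nat.div2_odd j). destruct (Nat.odd j); simpl in E.
- assert (H := proj1 (spectrum_levels (Nat.div2 j))).
  now replace (2 * Nat.div2 j + 1)%nat with j in H by lia.
- assert (H := proj2 (spectrum_levels (Nat.div2 j - 1))).
  replace (2 * (Nat.div2 j - 1) + 2)%nat with j in H by lia.
  now replace (Nat.div2 j - 1 + 1)%nat with (Nat.div2 j) in H by lia.
Qed.
End Enumeration.
End Hill.

Theorem theorem1p2 (a : R) (a_gt0 : 0 < a)
    (V : R -> R) (V_Fp : Fp a V) (V_analytic : real_analytic V)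
    (V_even : forall x : R, V x = V (- x))
    (lam : nat -> R) (lam_spectrum : is_spectrum a V lam)
    (f : nat -> R -> R) (f_basis : eigenbasis a V lam f) :
  (forall j : nat, (1 <= j)%nat ->
     exists n : nat, (n <= 2)%nat /\ has_dim (eigenspace a V (lam j)) n) /\
  (forall j : nat, (1 <= j)%nat -> has_dim (eigenspace a V (lam j)) 1 ->
     exists g : R -> R,
       eigenfunction a V (lam j) g /\
       is_basis (eigenspace a V (lam j)) [g] /\
       ((g 0 = 1 /\ Derive g 0 = 0) \/ (g 0 = 0 /\ Derive g 0 = 1))) /\
  (forall j : nat, (1 <= j)%nat -> has_dim (eigenspace a V (lam j)) 2 ->
     lam j = lam (j + 1)%nat ->
     exists g h : R -> R,
       is_basis (eigenspace a V (lam j)) [g; h] /\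
       g 0 = 1 /\ Derive g 0 = 0 /\ h 0 = 0 /\ Derive h 0 = 1) /\
  (forall j : nat, (1 <= j)%nat ->
     forall g : R -> R, eigenfunction a V (lam j) g ->
       has_nodes a g (if Nat.even j then j else (j - 1)%nat)).
Proof.
assert (V_cont : forall x, continuous V x).
{ intros x. apply (ex_derive_continuous V), (proj1 V_Fp 1%nat). }
destruct (periodic_bounded a V a_gt0 V_cont (proj2 V_Fp)) as [B HB].
repeat split.
- intros j Hj. destruct (spectrum_list a V lam lam_spectrum (lam j)) as [l [_ [_ Hd]]].
  exists (length l). split; [| easy].
  exact (eigenspace_dim_le_2 a V B V_Fp HB (lam j) _ Hd).
- intros j _ H1. exact (eigenspace_one_basis a V B V_Fp V_even HB (lam j) H1).
- intros j _ H2 _.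
  exists (cosine_like (shifted V (lam j))), (sine_like (shifted V (lam j))).
  split; [| repeat split].
  + exact (eigenspace_two_basis a V B V_Fp V_even HB (lam j) H2).
  + apply cosine_0.
  + apply (Derive_cosine_0 a V B V_Fp HB).
  + apply sine_0.
  + apply (Derive_sine_0 a V B V_Fp HB).
- intros j Hj g Hg.
  assert (E := Nat.div2_odd j). rewrite <- Nat.negb_even in E.
  replace (if Nat.even j then j else (j - 1)%nat) with (2 * Nat.div2 j)%nat
    by (destruct (Nat.even j); simpl in *; lia).
  apply (level_nodes a V B a_gt0 V_Fp V_even HB (lam j)); [| easy].
  now apply (lam_level a V B a_gt0 V_Fp V_even HB lam lam_spectrum).
Qed.
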